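(* Let $A$ generate a linear $C_0$-semigroup $S_0(t)$ of contractions on a real Hilbert space $H$. Let $B:H\to H$ be a (possibly nonlinear) operator with $B(0)=0$ which is positive, i.e. $\langle Bz,z\rangle\ge 0$ for all $z\in H$, and Lipschitz on every bounded subset of $H$. Assume that there exist constants $T,\delta>0$ such that $$\int_0^T |\langle BS_0(t)y,S_0(t)y\rangle|\,dt\ \ge\ \delta\|y\|^2,\qquad \forall y\in H.$$ Then for any $R>0$ there exists $\lambda_R>0$ such that for all $0<\lambda<\lambda_R$ there are constants $M_R,\sigma_R>0$ for which the following holds: for every $z_0\in H$ with $\|z_0\|\le R$, the mild solution $z(t)$ of $$\frac{dz(t)}{dt}=Az(t)+v(t)Bz(t),\qquad z(0)=z_0,$$ with the constant control $v(t)=-\lambda$ satisfies $$\|z(t)\|\le M_R e^{-\sigma_R t}\|z_0\|,\qquad \forall t\ge 0.$$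
   Context: $H$ is a real Hilbert space with inner product $\langle\cdot,\cdot\rangle$ and norm $\|\cdot\|$. For a constant control $v(t)=-\lambda$, a mild solution of $\dot z=Az+vBz$, $z(0)=z_0$, is a continuous function $z:[0,\infty)\to H$ satisfying $z(t)=S_0(t)z_0-\lambda\int_0^t S_0(t-s)Bz(s)\,ds$ for all $t\ge 0$. *)

(* Defs.v *)
From Stdlib Require Import Reals.
From Coquelicot Require Import Coquelicot.
Open Scope R_scope.

(* [H] together with such an [inner] is a real Hilbert space: completeness and
   the norm come from [CompleteNormedModule], and definiteness of [inner]
   follows from [inner_norm]. *)
Record is_inner_product (H : CompleteNormedModule R_AbsRing)
    (inner : H -> H -> R) : Prop := {
  inner_sym : forall x y : H, inner x y = inner y x;
  inner_plus_l : forall x y z : H,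
    inner (plus x y) z = inner x z + inner y z;
  inner_scal_l : forall (a : R) (x y : H), inner (scal a x) y = a * inner x y;
  inner_norm : forall x : H, inner x x = norm x ^ 2
}.

(* Only the values [S t] with [0 <= t] are meaningful.  Coquelicot's [is_linear]
   includes boundedness. *)
Record is_C0_semigroup (H : CompleteNormedModule R_AbsRing)
    (S : R -> H -> H) : Prop := {
  C0_linear : forall t : R, 0 <= t -> is_linear (S t);
  C0_zero : forall x : H, S 0 x = x;
  C0_plus : forall (s t : R) (x : H), 0 <= s -> 0 <= t ->
    S (s + t) x = S s (S t x);
  C0_continuous : forall x : H,
    filterlim (fun t => S t x) (at_right 0) (locally x)
}.

Definition is_contraction_semigroup (H : CompleteNormedModule R_AbsRing)
    (S : R -> H -> H) : Prop :=
  is_C0_semigroup H S /\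
  forall (t : R) (x : H), 0 <= t -> norm (S t x) <= norm x.

(* The unbounded operator with domain [domA] is represented by a total function
   [A] whose values outside [domA] are irrelevant. *)
Definition is_generator (H : CompleteNormedModule R_AbsRing)
    (domA : H -> Prop) (A : H -> H) (S : R -> H -> H) : Prop :=
  let quotient (x : H) (h : R) : H := scal (/ h) (minus (S h x) x) in
  (forall x : H, domA x <->
     exists y : H, filterlim (quotient x) (at_right 0) (locally y)) /\
  (forall x : H, domA x -> filterlim (quotient x) (at_right 0) (locally (A x))).

Definition is_bounded_subset (H : CompleteNormedModule R_AbsRing)
    (E : H -> Prop) : Prop :=
  exists r : R, forall x : H, E x -> norm x <= r.

Definition lipschitz_on_bounded_subsets (H : CompleteNormedModule R_AbsRing)
    (B : H -> H) : Prop :=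
  forall E : H -> Prop, is_bounded_subset H E ->
  exists L : R, forall x y : H, E x -> E y ->
    norm (minus (B x) (B y)) <= L * norm (minus x y).

(* Mild solution of [z' = A z + v B z], [z(0) = z0], for the constant control
   [v = - lambda], where [S] is the semigroup generated by [A].  For Lipschitz
   [B] the continuity of [z] makes the integrand continuous on [[0, t]], so that
   the total operator [RInt] is the genuine [H]-valued Riemann integral. *)
Definition is_mild_solution (H : CompleteNormedModule R_AbsRing)
    (S : R -> H -> H) (B : H -> H) (lambda : R) (z0 : H) (z : R -> H) : Prop :=
  continuous_on (fun t => 0 <= t) z /\
  forall t : R, 0 <= t ->
    z t = minus (S t z0)
                (scal lambda (RInt (fun s => S (t - s) (B (z s))) 0 t)).

(* Main.v *)
(* The flow is dissipative: a Dini-derivative argument gives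
   |z(b)|^2 + 2 lambda int_a^b <Bz, z> <= |z(a)|^2 for every mild solution, so the
   norm decreases and only the Lipschitz constant L of B on the ball of radius R0
   matters.  On a period [s, s + T] Duhamel's formula gives
   |z(s + t) - S(t) z(s)| <= lambda L T |z(s)|, so the observability inequality
   transfers from the free orbit of z(s) to z up to an error
   2 lambda L^2 T^2 |z(s)|^2.  For small lambda the energy balance becomes
   |z(s + T)|^2 <= (1 - lambda delta) |z(s)|^2, whence exponential decay.  Global
   existence comes from composing B with the radial projection onto the ball. *)
Require Import Defs.
From Stdlib Require Import Reals Lra Lia Psatz.
From Coquelicot Require Import Coquelicot.
Open Scope R_scope.

(** * Norms, continuity and integrals in a complete normed module *)

(** The obstacle is regularity: a mild solution need not be differentiable or stay in the domain of
    the generator, so its squared norm cannot simply be differentiated. The substitute is Duhamel's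
    formula restarted at t, u(t + h) = S(h) u(t) + D with D = h f(t) + o(h): contractivity bounds
    the first term, and D contributes the power 2 h <f(t), u(t)>. This controls forward increments
    only, hence the right-sided Dini derivatives. The energy estimate then serves twice. Applied to
    the truncated equation, it keeps the constructed solution in the ball, where the truncation is
    invisible. Applied a priori to an arbitrary mild solution of the original equation, it keeps
    that one in the ball too, so uniqueness reduces to a globally Lipschitz equation. The resulting
    decay constants depend on the initial state only through the radius of the ball, by way of the
    admissible gains. *)

Lemma continuous_normP (V : CompleteNormedModule R_AbsRing) (f : R -> V) (x : R) :
  continuous f x <->
  (forall eps, 0 < eps -> exists d, 0 < d /\
     forall y, Rabs (y - x) < d -> norm (minus (f y) (f x)) < eps).
Proof.
  split.
  - intros Hc eps Heps.
    (* Uniform balls and norm balls agree only up to [norm_factor], so the radius is rescaled. *)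
    assert (Hk := @norm_factor_gt_0 R_AbsRing V).
    assert (He : 0 < eps / @norm_factor R_AbsRing V) by now apply Rdiv_lt_0_compat.
    destruct (proj1 (filterlim_locally f (f x)) Hc (mkposreal _ He)) as [d Hd].
    exists d; split; [apply cond_pos|]; intros y Hy.
    replace eps with (@norm_factor R_AbsRing V * mkposreal _ He) by (simpl; field; lra).
    apply (@norm_compat2 R_AbsRing V), Hd, Hy.
  - intros Hc; apply filterlim_locally; intros eps.
    destruct (Hc eps (cond_pos eps)) as [d [Hd Hf]].
    exists (mkposreal d Hd); intros y Hy.
    apply (@norm_compat1 R_AbsRing V), Hf, Hy.
Qed.

(** The maximum of a and b is (a + b + |a - b|) / 2. *)
Lemma continuous_Rmax (f g : R -> R) (x : R) :
  continuous f x -> continuous g x -> continuous (fun t => Rmax (f t) (g t)) x.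
Proof.
  intros Hf Hg.
  apply continuous_ext with
    (fun t => scal (/ 2) (plus (plus (f t) (g t)) (Rabs (minus (f t) (g t))))).
  - intros t; unfold scal, plus, minus, opp; simpl; unfold mult, plus, opp; simpl.
    unfold Rmax, Rabs; destruct (Rle_dec _ _), (Rcase_abs _); lra.
  - apply @continuous_scal_r, @continuous_plus.
    + now apply @continuous_plus.
    + apply (continuous_comp _ Rabs); [now apply @continuous_minus|].
      apply continuous_Rabs.
Qed.

Lemma minusE (G : AbelianGroup) (x y : G) : minus x y = plus x (opp y).
Proof. reflexivity. Qed.

Lemma group_minus_plus_plus (G : AbelianGroup) (a b c d : G) :
  minus (plus a b) (plus c d) = plus (minus a c) (minus b d).
Proof.
  rewrite !minusE, opp_plus, <- !plus_assoc; f_equal.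
  rewrite !plus_assoc; f_equal; apply plus_comm.
Qed.

Lemma group_minus_plusK (G : AbelianGroup) (x y : G) : plus (minus x y) y = x.
Proof. now rewrite minusE, <- plus_assoc, plus_opp_l, plus_zero_r. Qed.

Lemma group_plus_minusK (G : AbelianGroup) (x y : G) : minus (plus x y) x = y.
Proof. now rewrite minusE, (plus_comm x), <- plus_assoc, plus_opp_r, plus_zero_r. Qed.

(* Coquelicot's coercions from [CompleteNormedModule] to the algebraic
   structures are only convertible, not identical, to those that go through
   [NormedModule]; rewriting needs the instances below. *)
Section CompleteModule.
Context (V : CompleteNormedModule R_AbsRing).

Lemma minus_plus_plus (a b c d : V) :
  minus (plus a b) (plus c d) = plus (minus a c) (minus b d).
Proof. exact (group_minus_plus_plus V a b c d). Qed.

Lemma minus_plusK (x y : V) : plus (minus x y) y = x.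
Proof. exact (group_minus_plusK V x y). Qed.

Lemma plus_minusK (x y : V) : minus (plus x y) x = y.
Proof. exact (group_plus_minusK V x y). Qed.

Lemma minus_chain (x y z : V) : plus (minus x y) (minus y z) = minus x z.
Proof. symmetry; exact (minus_trans y x z). Qed.

Lemma minus_diag (x : V) : minus x x = zero.
Proof. exact (minus_eq_zero x). Qed.

Lemma plus_opp_minus (x y : V) : plus x (opp y) = minus x y.
Proof. reflexivity. Qed.

Lemma minus_zero_R (x : V) : minus x zero = x.
Proof. exact (minus_zero_r x). Qed.

Lemma opp_scal_R (x : V) : opp x = scal (-1) x.
Proof. symmetry; exact (scal_opp_one x). Qed.

Lemma scal_0_R (x : V) : scal 0 x = zero.
Proof. exact (scal_zero_l x). Qed.

Lemma scal_1_R (x : V) : scal 1 x = x.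
Proof. exact (scal_one x). Qed.

Lemma scal_scal_R (a b : R) (x : V) : scal a (scal b x) = scal (a * b) x.
Proof. exact (scal_assoc a b x). Qed.

Lemma scal_minus_R (a : R) (x y : V) :
  scal a (minus x y) = minus (scal a x) (scal a y).
Proof. exact (scal_minus_distr_l a x y). Qed.

Lemma norm_zero_R : norm (zero : V) = 0.
Proof. exact (@norm_zero R_AbsRing V). Qed.

Lemma norm_opp_R (x : V) : norm (opp x) = norm x.
Proof. exact (@norm_opp R_AbsRing V x). Qed.

Lemma norm_plus_le (x y : V) : norm (plus x y) <= norm x + norm y.
Proof. exact (@norm_triangle R_AbsRing V x y). Qed.

Lemma norm_minus_sym (x y : V) : norm (minus x y) = norm (minus y x).
Proof.
  rewrite <- (norm_opp_R (minus x y)); f_equal; exact (opp_minus x y).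
Qed.

Lemma norm_minus_le (x y : V) : norm (minus x y) <= norm x + norm y.
Proof. rewrite <- (norm_opp_R y); apply norm_plus_le. Qed.

Lemma norm_minus_triangle (x y z : V) :
  norm (minus x z) <= norm (minus x y) + norm (minus y z).
Proof. rewrite <- (minus_chain x y z); apply norm_plus_le. Qed.

Lemma norm_le_minus (x y : V) : norm x <= norm (minus x y) + norm y.
Proof. rewrite <- (minus_plusK x y) at 1; apply norm_plus_le. Qed.

Lemma Rabs_norm_minus (x y : V) : Rabs (norm x - norm y) <= norm (minus x y).
Proof. exact (@norm_triangle_inv R_AbsRing V x y). Qed.

(** The axioms give only the upper bound; the reverse one is that bound for [/ a] applied to
    [scal a x]. *)
Lemma norm_scal_R (a : R) (x : V) : norm (scal a x) = Rabs a * norm x.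
Proof.
  assert (Hle : forall b (y : V), norm (scal b y) <= Rabs b * norm y)
    by exact (@norm_scal R_AbsRing V).
  destruct (Req_dec a 0) as [->|Ha].
  - rewrite scal_0_R, Rabs_R0, Rmult_0_l; apply norm_zero_R.
  - apply Rle_antisym; [apply Hle|].
    apply Rmult_le_reg_l with (Rabs (/ a)); [now apply Rabs_pos_lt, Rinv_neq_0_compat|].
    rewrite <- Rmult_assoc, <- Rabs_mult, Rinv_l, Rabs_R1, Rmult_1_l by easy.
    rewrite <- (scal_1_R x) at 1; rewrite <- (Rinv_l a), <- scal_scal_R by easy.
    apply Hle.
Qed.

Lemma continuous_plus_R (f g : R -> V) (t : R) :
  continuous f t -> continuous g t -> continuous (fun s => plus (f s) (g s)) t.
Proof. exact (@continuous_plus R_UniformSpace R_AbsRing V f g t). Qed.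

Lemma continuous_minus_R (f g : R -> V) (t : R) :
  continuous f t -> continuous g t -> continuous (fun s => minus (f s) (g s)) t.
Proof. exact (@continuous_minus R_UniformSpace R_AbsRing V f g t). Qed.

Lemma continuous_norm_R (f : R -> V) (t : R) :
  continuous f t -> continuous (fun s => norm (f s)) t.
Proof.
  intros Hf; apply (continuous_comp f norm); [easy|].
  exact (@filterlim_norm R_AbsRing V (f t)).
Qed.

Lemma ex_RInt_cont (f : R -> V) (a b : R) :
  (forall t, continuous f t) -> ex_RInt f a b.
Proof. intros Hf; apply (ex_RInt_continuous f); intros t _; apply Hf. Qed.

Lemma norm_RInt_le_scaled (f : R -> V) (a b C : R) :
  a <= b -> (forall t, continuous f t) ->
  (forall t, a <= t <= b -> norm (f t) <= C) ->
  norm (RInt f a b) <= (b - a) * C.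
Proof.
  intros Hab Hf HC.
  apply (@norm_RInt_le_const V f a b); [easy..|].
  now apply (RInt_correct f), ex_RInt_cont.
Qed.

Lemma minus_RInt_const (f : R -> V) (c : V) (a b : R) :
  (forall t, continuous f t) ->
  minus (RInt f a b) (scal (b - a) c) = RInt (fun t => minus (f t) c) a b.
Proof.
  intros Hf; rewrite <- (RInt_const a b c); symmetry.
  apply (RInt_minus f (fun _ => c)); apply ex_RInt_cont; [easy|].
  intros t; apply continuous_const.
Qed.

Lemma RInt_near_const (f : R -> V) (t eps : R) :
  (forall s, continuous f s) -> 0 < eps ->
  exists d, 0 < d /\ forall h, 0 < h < d ->
    norm (minus (RInt f t (t + h)) (scal h (f t))) <= h * eps.
Proof.
  intros Hf Heps.
  destruct (proj1 (continuous_normP V f t) (Hf t) eps Heps) as [d [Hd Hfd]].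
  exists d; split; [easy|]; intros h Hh.
  replace h with (t + h - t) at 2 3 by ring.
  rewrite minus_RInt_const by easy.
  apply norm_RInt_le_scaled; [lra|..].
  - intros s; apply continuous_minus_R; [apply Hf|apply continuous_const].
  - intros s Hs; left; apply Hfd, Rabs_def1; lra.
Qed.

End CompleteModule.

(** * Inner products *)

Section Inner.
Context (H : CompleteNormedModule R_AbsRing) (inner : H -> H -> R)
  (Hinner : is_inner_product H inner).

Lemma inner_plus_r (x y z : H) : inner x (plus y z) = inner x y + inner x z.
Proof.
  rewrite (inner_sym _ _ Hinner), (inner_plus_l _ _ Hinner).
  now rewrite !(inner_sym _ _ Hinner x).
Qed.

Lemma inner_scal_r (a : R) (x y : H) : inner x (scal a y) = a * inner x y.
Proof.
  rewrite (inner_sym _ _ Hinner), (inner_scal_l _ _ Hinner).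
  now rewrite (inner_sym _ _ Hinner x).
Qed.

Lemma inner_opp_l (x y : H) : inner (opp x) y = - inner x y.
Proof.
  rewrite (opp_scal_R H x), (inner_scal_l _ _ Hinner); ring.
Qed.

Lemma inner_zero_l (x : H) : inner zero x = 0.
Proof.
  transitivity (inner (scal 0 x) x).
  - f_equal; symmetry; apply (scal_0_R H).
  - rewrite (inner_scal_l _ _ Hinner); ring.
Qed.

Lemma inner_minus_l (x y z : H) : inner (minus x y) z = inner x z - inner y z.
Proof.
  rewrite <- plus_opp_minus, (inner_plus_l _ _ Hinner), inner_opp_l; ring.
Qed.

Lemma inner_minus_r (x y z : H) : inner x (minus y z) = inner x y - inner x z.
Proof.
  rewrite (inner_sym _ _ Hinner), inner_minus_l.
  now rewrite !(inner_sym _ _ Hinner x).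
Qed.

Lemma norm_plus_sqr (x y : H) :
  norm (plus x y) ^ 2 = norm x ^ 2 + 2 * inner x y + norm y ^ 2.
Proof.
  rewrite <- !(inner_norm _ _ Hinner), inner_plus_r, !(inner_plus_l _ _ Hinner).
  rewrite (inner_sym _ _ Hinner y x); ring.
Qed.

(** Cauchy-Schwarz: expand the square of | |y| x - |x| y | and divide by |x| |y|; zero vectors are
    treated apart. *)
Lemma inner_le_norm (x y : H) : inner x y <= norm x * norm y.
Proof.
  destruct (norm_ge_0 x) as [Hx|Hx], (norm_ge_0 y) as [Hy|Hy].
  - assert (Hn := pow2_ge_0 (norm (minus (scal (norm y) x) (scal (norm x) y)))).
    rewrite <- (inner_norm _ _ Hinner), inner_minus_r, !inner_minus_l in Hn.
    rewrite !inner_scal_r, !(inner_scal_l _ _ Hinner), !(inner_norm _ _ Hinner) in Hn.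
    rewrite (inner_sym _ _ Hinner y x) in Hn.
    assert (Hxy := Rmult_lt_0_compat _ _ Hx Hy).
    apply Rmult_le_reg_l with (norm x * norm y); [easy|]; nra.
  - rewrite <- Hy; apply eq_sym, norm_eq_zero in Hy; subst y.
    rewrite (inner_sym _ _ Hinner), Rmult_0_r; apply Req_le, inner_zero_l.
  - rewrite <- Hx; apply eq_sym, norm_eq_zero in Hx; subst x.
    rewrite Rmult_0_l; apply Req_le, inner_zero_l.
  - rewrite <- Hy; apply eq_sym, norm_eq_zero in Hy; subst y.
    rewrite (inner_sym _ _ Hinner), Rmult_0_r; apply Req_le, inner_zero_l.
Qed.

(** Polarization reduces the claim to continuity of the norm. *)
Lemma continuous_inner (f g : R -> H) (t : R) :
  continuous f t -> continuous g t -> continuous (fun s => inner (f s) (g s)) t.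
Proof.
  intros Hf Hg.
  apply (continuous_ext (fun s => plus
    (scal (/ 2) (minus (norm (plus (f s) (g s)) ^ 2) (norm (f s) ^ 2)))
    (scal (- / 2) (norm (g s) ^ 2)))).
  - intros s; rewrite norm_plus_sqr.
    unfold scal, plus, minus, opp; simpl; unfold mult, plus, opp; simpl; field.
  - assert (Hsqr : forall h : R -> H, continuous h t ->
      continuous (fun s => norm (h s) ^ 2) t).
    { intros h Hh; apply (continuous_comp (fun s => norm (h s)) (fun x => x ^ 2)).
      - apply (continuous_comp h norm); [easy|apply (filterlim_norm (h t))].
      - apply continuity_pt_filterlim; reg. }
    apply @continuous_plus; apply @continuous_scal_r; [apply @continuous_minus|];
      apply Hsqr; try easy.
    now apply (@continuous_plus R_UniformSpace R_AbsRing H f g).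
Qed.

End Inner.

(** * Contraction semigroups, Duhamel integrals and energy *)

Lemma Riemann_sum_linear (U V : NormedModule R_AbsRing) (l : U -> V)
    (f : R -> U) (ptd : SF_seq) :
  is_linear l ->
  Riemann_sum (fun t => l (f t)) ptd = l (Riemann_sum f ptd).
Proof.
  intros Hl; induction ptd as [x0|h ptd IH] using SF_cons_ind.
  - symmetry; apply (linear_zero l Hl).
  - rewrite !Riemann_sum_cons, IH.
    rewrite (linear_plus l Hl); f_equal.
    symmetry; apply (linear_scal l Hl).
Qed.

(** Riemann sums commute with [l], and boundedness carries this to the limit. It is what lets a
    semigroup operator leave a Duhamel integral. *)
Lemma is_RInt_linear (U V : NormedModule R_AbsRing) (l : U -> V)
    (f : R -> U) (a b : R) (v : U) :
  is_linear l -> is_RInt f a b v -> is_RInt (fun t => l (f t)) a b (l v).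
Proof.
  intros Hl Hf.
  apply filterlim_ext with
    (fun ptd => l (scal (sign (b - a)) (Riemann_sum f ptd))).
  - intros ptd; rewrite (linear_scal l Hl); f_equal.
    now symmetry; apply Riemann_sum_linear.
  - eapply filterlim_comp; [exact Hf|apply (linear_cont l v Hl)].
Qed.

(** Supremum argument: if [phi b] exceeded [phi a], some line of slope [eps] > 0 from [phi a] would
    still end below [phi b]. Let m be the supremum of the times up to which [phi] stays under that
    line. Continuity puts m itself under it, and the Dini bound at m pushes further unless m = b. *)
Lemma right_dini_nonincreasing (phi : R -> R) (a b : R) :
  a <= b ->
  (forall t, a <= t <= b -> continuous phi t) ->
  (forall t, a <= t < b -> forall eps, 0 < eps ->
     exists d, 0 < d /\ forall h, 0 < h < d -> phi (t + h) <= phi t + eps * h) ->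
  phi b <= phi a.
Proof.
  intros Hab Hc Hd.
  apply Rnot_lt_le; intros Hlt.
  set (eps := (phi b - phi a) / (2 * (b - a + 1))).
  assert (Heps : 0 < eps) by (apply Rdiv_lt_0_compat; lra).
  assert (Hb : phi a + eps * (b - a) < phi b).
  { assert (eps * (2 * (b - a + 1)) = phi b - phi a) by (unfold eps; field; lra).
    nra. }
  set (E := fun t => a <= t <= b /\
    forall s, a <= s <= t -> phi s <= phi a + eps * (s - a)).
  destruct (completeness E) as [m [Hub Hlub]].
  - exists b; intros t [Ht _]; lra.
  - exists a; split; [lra|]; intros s Hs; replace s with a by lra; lra.
  - assert (Ham : a <= m).
    { apply Hub; split; [lra|]; intros s Hs; replace s with a by lra; lra. }
    assert (Hmb : m <= b) by (apply Hlub; intros t [Ht _]; lra).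
    assert (Hbelow : forall s, a <= s < m -> phi s <= phi a + eps * (s - a)).
    { intros s Hs; apply Rnot_lt_le; intros Hn.
      assert (Hsm : m <= s); [|lra].
      apply Hlub; intros t [Ht HE]; apply Rnot_lt_le; intros Hst.
      specialize (HE s ltac:(lra)); lra. }
    assert (Hm : phi m <= phi a + eps * (m - a)).
    { apply Rnot_lt_le; intros Hn.
      destruct (Req_dec a m) as [Heq|Hne]; [subst m; lra|].
      set (e := phi m - (phi a + eps * (m - a))).
      destruct (proj1 (continuous_normP R_CompleteNormedModule phi m)
                  (Hc m (conj Ham Hmb)) e) as [d [Hd0 Hcd]]; [unfold e; lra|].
      (* A point of [a, m) close enough to m that the excess [e] at m would already show there. *)
      set (s := Rmax a (m - d / 2)).
      assert (Hs : a <= s < m) by (unfold s; split; [apply Rmax_l|apply Rmax_lub_lt; lra]).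
      assert (Hs' : m - d / 2 <= s) by apply Rmax_r.
      specialize (Hbelow s Hs); specialize (Hcd s).
      change (Rabs (s - m) < d -> Rabs (phi s - phi m) < e) in Hcd.
      assert (Hlt' : Rabs (phi s - phi m) < e) by (apply Hcd, Rabs_def1; lra).
      apply Rabs_def2 in Hlt'; unfold e in Hlt'; nra. }
    destruct (Req_dec m b) as [->|Hne]; [lra|].
    destruct (Hd m ltac:(lra) eps Heps) as [d [Hd0 Hdm]].
    set (h := Rmin (d / 2) (b - m)).
    assert (Hh : 0 < h <= b - m) by (unfold h; split; [apply Rmin_glb_lt; lra|apply Rmin_r]).
    assert (Hhd : h <= d / 2) by apply Rmin_l.
    assert (HE : E (m + h)).
    { split; [lra|]; intros s Hs.
      destruct (Rlt_le_dec s m) as [Hsm|Hsm]; [apply Hbelow; lra|].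
      destruct (Req_dec s m) as [->|Hsm']; [easy|].
      specialize (Hdm (s - m) ltac:(lra)).
      replace (m + (s - m)) with s in Hdm by ring; nra. }
    specialize (Hub _ HE); lra.
Qed.

Section Semigroup.
Context (H : CompleteNormedModule R_AbsRing) (SG : R -> H -> H)
  (HSG : is_contraction_semigroup H SG).

Lemma SG_linear (t : R) : 0 <= t -> is_linear (SG t).
Proof. apply (C0_linear _ _ (proj1 HSG)). Qed.

Lemma SG_minus (t : R) (x y : H) :
  0 <= t -> SG t (minus x y) = minus (SG t x) (SG t y).
Proof. intros Ht; apply (linear_minus _ x y (SG_linear t Ht)). Qed.

Lemma SG_scal (t a : R) (x : H) : 0 <= t -> SG t (scal a x) = scal a (SG t x).
Proof. intros Ht; apply (linear_scal _ (SG_linear t Ht)). Qed.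

Lemma SG_plus (t : R) (x y : H) :
  0 <= t -> SG t (plus x y) = plus (SG t x) (SG t y).
Proof. intros Ht; apply (linear_plus _ (SG_linear t Ht)). Qed.

Lemma SG_norm (t : R) (x : H) : 0 <= t -> norm (SG t x) <= norm x.
Proof. apply (proj2 HSG). Qed.

Lemma SG_0 (x : H) : SG 0 x = x.
Proof. apply (C0_zero _ _ (proj1 HSG)). Qed.

Lemma SG_add (s t : R) (x : H) :
  0 <= s -> 0 <= t -> SG (s + t) x = SG s (SG t x).
Proof. apply (C0_plus _ _ (proj1 HSG)). Qed.

Lemma SG_right_continuous (x : H) (eps : R) : 0 < eps ->
  exists d, 0 < d /\
    forall t, 0 <= t < d -> norm (minus (SG t x) x) < eps.
Proof.
  intros Heps.
  assert (Hk := @norm_factor_gt_0 R_AbsRing H).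
  assert (He : 0 < eps / @norm_factor R_AbsRing H) by now apply Rdiv_lt_0_compat.
  destruct (proj1 (filterlim_locally _ _) (C0_continuous _ _ (proj1 HSG) x)
              (mkposreal _ He)) as [d Hd].
  exists d; split; [apply cond_pos|]; intros t Ht.
  destruct (Req_dec t 0) as [->|Hne].
  - rewrite SG_0, minus_diag, norm_zero_R; easy.
  - replace eps with (@norm_factor R_AbsRing H * mkposreal _ He) by (simpl; field; lra).
    apply (@norm_compat2 R_AbsRing H), Hd; [|lra].
    change (Rabs (t - 0) < d); apply Rabs_def1; lra.
Qed.

(** For s <= t the increment is S(s) applied to S(t - s) x - x. Continuity at 0 thus becomes uniform
    in time along an orbit. *)
Lemma SG_increment (a b : R) (x : H) : 0 <= a -> 0 <= b ->
  norm (minus (SG a x) (SG b x)) <= norm (minus (SG (Rabs (a - b)) x) x).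
Proof.
  assert (Hle : forall s t, 0 <= s <= t ->
    norm (minus (SG t x) (SG s x)) <= norm (minus (SG (t - s) x) x)).
  { intros s t Hst; replace t with (s + (t - s)) at 1 by ring.
    rewrite SG_add, <- SG_minus by lra; apply SG_norm; lra. }
  intros Ha Hb; destruct (Rle_dec a b) as [Hab|Hab].
  - rewrite norm_minus_sym, Rabs_minus_sym, Rabs_pos_eq by lra; apply Hle; lra.
  - rewrite Rabs_pos_eq by lra; apply Hle; lra.
Qed.

(* [SG] is only meaningful on [[0, +oo)]; clamping the time at [0] makes the
   orbits, hence all integrands below, continuous on the whole line. *)
Lemma SG_continuous (tau : R -> R) (f : R -> H) (t : R) :
  continuous tau t -> continuous f t ->
  continuous (fun s => SG (Rmax 0 (tau s)) (f s)) t.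
Proof.
  intros Htau Hf.
  assert (Hm : continuous (fun s => Rmax 0 (tau s)) t).
  { apply continuous_Rmax; [apply continuous_const|easy]. }
  apply continuous_normP; intros eps Heps.
  destruct (proj1 (continuous_normP _ _ _) Hf (eps / 2)) as [d1 [Hd1 Hf1]]; [lra|].
  destruct (SG_right_continuous (f t) (eps / 2)) as [d2 [Hd2 HS2]]; [lra|].
  destruct (proj1 (continuous_normP R_CompleteNormedModule _ _) Hm d2 Hd2)
    as [d3 [Hd3 Hm3]].
  exists (Rmin d1 d3); split; [now apply Rmin_glb_lt|]; intros s Hs.
  assert (Hs1 : Rabs (s - t) < d1) by (eapply Rlt_le_trans; [exact Hs|apply Rmin_l]).
  assert (Hs3 : Rabs (s - t) < d3) by (eapply Rlt_le_trans; [exact Hs|apply Rmin_r]).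
  specialize (Hf1 s Hs1); specialize (Hm3 s Hs3).
  change (Rabs (Rmax 0 (tau s) - Rmax 0 (tau t)) < d2) in Hm3.
  assert (P := fun r => Rmax_l 0 r : 0 <= Rmax 0 r).
  (* Vary the vector first, at no cost for a contraction, and then the time. *)
  eapply Rle_lt_trans; [apply norm_minus_triangle with (y := SG (Rmax 0 (tau s)) (f t))|].
  rewrite <- SG_minus by apply P.
  assert (A1 := SG_norm (Rmax 0 (tau s)) (minus (f s) (f t)) (P _)).
  assert (A2 := SG_increment _ _ (f t) (P (tau s)) (P (tau t))).
  specialize (HS2 (Rabs (Rmax 0 (tau s) - Rmax 0 (tau t)))
    (conj (Rabs_pos _) Hm3)); lra.
Qed.

(** * Duhamel integrals *)

Definition duhamel (f : R -> H) (a b : R) : H :=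
  RInt (fun s => SG (Rmax 0 (b - s)) (f s)) a b.

Lemma duhamel_integrand_continuous (f : R -> H) (b t : R) :
  (forall s, continuous f s) ->
  continuous (fun s => SG (Rmax 0 (b - s)) (f s)) t.
Proof.
  intros Hf; apply (SG_continuous (fun s => b - s)); [|apply Hf].
  apply (continuous_minus (fun _ => b) (fun s => s));
    [apply continuous_const|apply continuous_id].
Qed.

Lemma duhamel_norm (f : R -> H) (g : R -> R) (a b v : R) :
  a <= b -> (forall s, continuous f s) ->
  (forall s, a <= s <= b -> norm (f s) <= g s) -> is_RInt g a b v ->
  norm (duhamel f a b) <= v.
Proof.
  intros Hab Hf Hg Hv.
  apply (@norm_RInt_le H (fun s => SG (Rmax 0 (b - s)) (f s)) g a b); try easy.
  - intros s Hs; eapply Rle_trans; [apply SG_norm, Rmax_l|now apply Hg].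
  - apply (RInt_correct (fun s => SG (Rmax 0 (b - s)) (f s))), ex_RInt_cont.
    intros t; now apply duhamel_integrand_continuous.
Qed.

Lemma duhamel_minus (f g : R -> H) (a b : R) :
  (forall s, continuous f s) -> (forall s, continuous g s) ->
  minus (duhamel f a b) (duhamel g a b) = duhamel (fun s => minus (f s) (g s)) a b.
Proof.
  intros Hf Hg; unfold duhamel.
  rewrite <- RInt_minus;
    [|apply ex_RInt_cont; intros t; now apply duhamel_integrand_continuous..].
  apply RInt_ext; intros s _; symmetry; apply SG_minus, Rmax_l.
Qed.

(** On [a, b] one has S(c - s) = S(c - b) S(b - s). This cocycle identity is what allows a
    trajectory to be restarted. *)
Lemma duhamel_split (f : R -> H) (a b c : R) :
  a <= b <= c -> (forall s, continuous f s) ->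
  duhamel f a c = plus (SG (c - b) (duhamel f a b)) (duhamel f b c).
Proof.
  intros Habc Hf.
  assert (Hex : forall t u v, ex_RInt (fun s => SG (Rmax 0 (t - s)) (f s)) u v).
  { intros t u v; apply ex_RInt_cont; intros s; now apply duhamel_integrand_continuous. }
  unfold duhamel at 1; rewrite <- (RInt_Chasles _ a b c) by apply Hex.
  f_equal; apply is_RInt_unique.
  apply is_RInt_ext with (fun s => SG (c - b) (SG (Rmax 0 (b - s)) (f s))).
  - rewrite Rmin_left, Rmax_right by lra; intros s Hs.
    rewrite <- SG_add by (try apply Rmax_l; lra); f_equal.
    rewrite !Rmax_right by lra; ring.
  - apply (is_RInt_linear H H); [apply SG_linear; lra|].
    apply (RInt_correct (fun s => SG (Rmax 0 (b - s)) (f s))), Hex.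
Qed.

(** After the substitution r = b - s, the operator S(r) no longer depends on the upper limit, so
    integrals with different upper limits can be compared through [f] alone. *)
Lemma duhamel_reverse (f : R -> H) (b : R) :
  (forall s, continuous f s) ->
  duhamel f 0 b = RInt (fun r => SG (Rmax 0 r) (f (b - r))) 0 b.
Proof.
  intros Hf.
  set (g := fun r => SG (Rmax 0 r) (f (b - r))).
  assert (Hg : forall t, continuous g t).
  { intros t; apply (SG_continuous (fun r => r)); [apply continuous_id|].
    apply (continuous_comp (fun r => b - r) f); [|apply Hf].
    apply (continuous_minus (fun _ => b) (fun s => s));
      [apply continuous_const|apply continuous_id]. }
  assert (Hlin := RInt_comp_lin g (-1) b 0 b (ex_RInt_cont H g _ _ Hg)).
  replace (-1 * 0 + b) with b in Hlin by ring.
  replace (-1 * b + b) with 0 in Hlin by ring.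
  rewrite <- (opp_RInt_swap g b 0), <- Hlin by now apply ex_RInt_cont.
  rewrite opp_scal_R, <- RInt_scal.
  - apply RInt_ext; intros s _; rewrite scal_scal_R.
    replace (-1 * -1) with 1 by ring; rewrite scal_1_R; unfold g.
    f_equal; [f_equal; ring|f_equal; ring].
  - apply (@ex_RInt_comp_lin H g (-1) b 0 b), ex_RInt_cont, Hg.
Qed.

(** In reversed form the difference is an integral over [a, b], bounded by (b - a) [M], plus one
    over [0, a] controlled by the uniform continuity of [f]. Each gets [eps / 2]; the [N + 1] avoids
    a division by zero. *)
Lemma duhamel_modulus (f : R -> H) (N eps : R) :
  (forall s, continuous f s) -> 0 <= N -> 0 < eps ->
  exists d, 0 < d /\ forall a b, 0 <= a <= b -> b <= N -> b - a < d ->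
    norm (minus (duhamel f 0 b) (duhamel f 0 a)) < eps.
Proof.
  intros Hf HN Heps.
  assert (Hg : forall c t, continuous (fun r => SG (Rmax 0 r) (f (c - r))) t).
  { intros c t; apply (SG_continuous (fun r => r)); [apply continuous_id|].
    apply (continuous_comp (fun r => c - r) f); [|apply Hf].
    apply (continuous_minus (fun _ => c) (fun s => s));
      [apply continuous_const|apply continuous_id]. }
  destruct (@bounded_continuity R_AbsRing H f 0 N (fun x _ => Hf x)) as [M HM].
  assert (HM0 : 0 < M) by (apply Rle_lt_trans with (norm (f 0)); [apply norm_ge_0|apply HM; lra]).
  assert (He : 0 < eps / (2 * (N + 1))) by (apply Rdiv_lt_0_compat; lra).
  destruct (@unifcont_normed_1d R_AbsRing H f 0 N (fun x _ => Hf x) (mkposreal _ He))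
    as [d1 Hd1].
  assert (Hd2 : 0 < eps / (2 * M)) by (apply Rdiv_lt_0_compat; lra).
  exists (Rmin d1 (eps / (2 * M))); split; [apply Rmin_glb_lt; [apply cond_pos|easy]|].
  intros a b Hab HbN Hd.
  assert (Hda : b - a < d1) by (eapply Rlt_le_trans; [exact Hd|apply Rmin_l]).
  assert (Hdb : b - a < eps / (2 * M)) by (eapply Rlt_le_trans; [exact Hd|apply Rmin_r]).
  rewrite !duhamel_reverse by easy.
  rewrite <- (RInt_Chasles (fun r => SG (Rmax 0 r) (f (b - r))) 0 a b)
    by (apply ex_RInt_cont, Hg).
  eapply Rle_lt_trans;
    [apply norm_minus_triangle with (y := RInt (fun r => SG (Rmax 0 r) (f (b - r))) 0 a)|].
  rewrite plus_minusK, <- RInt_minus by (apply ex_RInt_cont, Hg).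
  assert (A1 : norm (RInt (fun r => SG (Rmax 0 r) (f (b - r))) a b) <= (b - a) * M).
  { apply norm_RInt_le_scaled; [lra|apply Hg|]; intros t Ht.
    eapply Rle_trans; [apply SG_norm, Rmax_l|left; apply HM; lra]. }
  assert (A2 : norm (RInt (fun r => minus (SG (Rmax 0 r) (f (b - r)))
                 (SG (Rmax 0 r) (f (a - r)))) 0 a) <= (a - 0) * (eps / (2 * (N + 1)))).
  { apply norm_RInt_le_scaled; [lra|..].
    - intros t; apply continuous_minus_R; apply Hg.
    - intros t Ht; rewrite <- SG_minus by apply Rmax_l.
      eapply Rle_trans; [apply SG_norm, Rmax_l|].
      left; apply (Hd1 (a - t) (b - t)); try lra.
      change (Rabs (b - t - (a - t)) < d1); apply Rabs_def1; lra. }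
  assert (A3 : (b - a) * M < eps / 2).
  { apply Rmult_lt_compat_r with (r := M) in Hdb; [|easy].
    replace (eps / (2 * M) * M) with (eps / 2) in Hdb by (field; lra); easy. }
  assert (A4 : (a - 0) * (eps / (2 * (N + 1))) <= eps / 2).
  { replace (eps / 2) with ((N + 1) * (eps / (2 * (N + 1)))) by (field; lra).
    apply Rmult_le_compat_r; lra. }
  eapply Rle_lt_trans; [apply Rplus_le_compat; [exact A1|exact A2]|lra].
Qed.

Lemma duhamel_continuous (f : R -> H) (t : R) :
  (forall s, continuous f s) -> continuous (fun s => duhamel f 0 (Rmax 0 s)) t.
Proof.
  intros Hf; apply continuous_normP; intros eps Heps.
  assert (P := fun r => Rmax_l 0 r : 0 <= Rmax 0 r).
  destruct (duhamel_modulus f (Rmax 0 t + 1) eps Hf ltac:(specialize (P t); lra) Heps)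
    as [d [Hd Hmod]].
  exists (Rmin 1 d); split; [apply Rmin_glb_lt; lra|]; intros s Hs.
  assert (Hs1 : Rabs (s - t) < 1) by (eapply Rlt_le_trans; [exact Hs|apply Rmin_l]).
  assert (Hsd : Rabs (s - t) < d) by (eapply Rlt_le_trans; [exact Hs|apply Rmin_r]).
  apply Rabs_def2 in Hs1; apply Rabs_def2 in Hsd.
  destruct (Rle_dec (Rmax 0 s) (Rmax 0 t)) as [Hst|Hst].
  - rewrite norm_minus_sym; apply Hmod; [split; [apply P|easy]|lra|].
    revert Hst; unfold Rmax; destruct (Rle_dec 0 s), (Rle_dec 0 t); lra.
  - apply Hmod; [split; [apply P|lra]|..];
      revert Hst; unfold Rmax; destruct (Rle_dec 0 s), (Rle_dec 0 t); lra.
Qed.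

Context (inner : H -> H -> R) (Hinner : is_inner_product H inner).

(** The function [phi] below, squared norm minus supplied energy, has nonpositive upper right Dini
    derivative: replacing |S(h) u(t)| by |u(t)| discards the dissipation of the semigroup with the
    right sign. *)
Lemma mild_energy (u f : R -> H) (a b : R) :
  (forall t, continuous u t) -> (forall t, continuous f t) ->
  (forall s t, a <= s <= t -> u t = plus (SG (t - s) (u s)) (duhamel f s t)) ->
  a <= b ->
  norm (u b) ^ 2 <= norm (u a) ^ 2 + 2 * RInt (fun s => inner (f s) (u s)) a b.
Proof.
  intros Hu Hf Hmild Hab.
  set (g := fun s => inner (f s) (u s)).
  assert (Hg : forall t, continuous g t).
  { intros t; apply (continuous_inner H inner Hinner); [apply Hf|apply Hu]. }
  assert (Hgi : forall s t, ex_RInt g s t).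
  { intros s t; apply (ex_RInt_cont R_CompleteNormedModule g), Hg. }
  set (phi := fun t => norm (u t) ^ 2 - 2 * RInt g a t).
  assert (Hphi : phi b <= phi a).
  { apply right_dini_nonincreasing; [easy|..].
    - intros t _; apply (continuous_minus (fun t => norm (u t) ^ 2) (fun t => 2 * RInt g a t)).
      + apply (continuous_comp (fun s => norm (u s)) (fun x => x ^ 2)).
        * apply continuous_norm_R, Hu.
        * apply continuity_pt_filterlim; reg.
      + apply (continuous_scal_r 2 (fun t => RInt g a t)).
        apply (continuous_RInt_1 g a t (fun t => RInt g a t)).
        apply filter_forall; intros s; apply (RInt_correct g), Hgi.
    - intros t Ht eps Heps.
      set (N := norm (u t)); set (F := norm (f t)).
      assert (HN : 0 <= N) by apply norm_ge_0.
      assert (HF : 0 <= F) by apply norm_ge_0.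
      (* The first-order expansion at [t] has an error of at most [h * eta * C]. *)
      set (C := 4 * N + 2 * (F + 2) + (F + 2) ^ 2 + 2).
      assert (HC : 0 < C) by (unfold C; nra).
      set (eta := Rmin 1 (eps / C)).
      assert (Heta : 0 < eta <= 1).
      { unfold eta; split; [|apply Rmin_l].
        apply Rmin_glb_lt; [lra|now apply Rdiv_lt_0_compat]. }
      assert (HetaC : eta * C <= eps).
      { apply Rle_trans with (eps / C * C); [|right; field; lra].
        apply Rmult_le_compat_r; [lra|apply Rmin_r]. }
      clearbody eta; destruct (proj1 (continuous_normP H f t) (Hf t) eta) as [d1 [Hd1 Hfd]]; [lra|].
      destruct (SG_right_continuous (f t) eta) as [d2 [Hd2 Hfs]]; [lra|].
      destruct (SG_right_continuous (u t) eta) as [d3 [Hd3 Hus]]; [lra|].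
      destruct (RInt_near_const R_CompleteNormedModule g t eta Hg) as [d4 [Hd4 Hgd]]; [lra|].
      (* Requiring h < [eta] turns the quadratic term |D|^2, of order h^2, into an error of order h
         * [eta]. *)
      exists (Rmin eta (Rmin (Rmin d1 d2) (Rmin d3 d4))); split.
      { repeat apply Rmin_glb_lt; lra. }
      intros h Hh.
      assert (Hhe : h < eta) by (eapply Rlt_le_trans; [apply Hh|apply Rmin_l]).
      assert (Hh' : h < Rmin (Rmin d1 d2) (Rmin d3 d4))
        by (eapply Rlt_le_trans; [apply Hh|apply Rmin_r]).
      assert (Hh12 : h < Rmin d1 d2) by (eapply Rlt_le_trans; [apply Hh'|apply Rmin_l]).
      assert (Hh34 : h < Rmin d3 d4) by (eapply Rlt_le_trans; [apply Hh'|apply Rmin_r]).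
      assert (Hh1 : h < d1) by (eapply Rlt_le_trans; [apply Hh12|apply Rmin_l]).
      assert (Hh2 : h < d2) by (eapply Rlt_le_trans; [apply Hh12|apply Rmin_r]).
      assert (Hh3 : h < d3) by (eapply Rlt_le_trans; [apply Hh34|apply Rmin_l]).
      assert (Hh4 : h < d4) by (eapply Rlt_le_trans; [apply Hh34|apply Rmin_r]).
      set (D := duhamel f t (t + h)).
      (* One [eta] pays for replacing f(s) by f(t), the other for removing the semigroup from
         f(t). *)
      assert (HD : norm (minus D (scal h (f t))) <= h * (2 * eta)).
      { apply Rle_trans with ((t + h - t) * (2 * eta)); [|right; ring].
        apply Rle_trans with (norm (minus D (scal (t + h - t) (f t)))).
        { right; do 3 f_equal; ring. }
        unfold D, duhamel.
        rewrite minus_RInt_const by (intros s; now apply duhamel_integrand_continuous).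
        apply norm_RInt_le_scaled; [lra|..].
        - intros s; apply continuous_minus_R;
            [now apply duhamel_integrand_continuous|apply continuous_const].
        - intros s Hs; eapply Rle_trans;
            [apply norm_minus_triangle with (y := SG (Rmax 0 (t + h - s)) (f t))|].
          rewrite <- SG_minus by apply Rmax_l.
          assert (A1 := SG_norm (Rmax 0 (t + h - s)) (minus (f s) (f t)) (Rmax_l _ _)).
          assert (A2 : norm (minus (f s) (f t)) < eta) by (apply Hfd, Rabs_def1; lra).
          assert (A3 := Hfs (Rmax 0 (t + h - s))).
          rewrite Rmax_right in A1, A3 |- * by lra.
          specialize (A3 ltac:(lra)); lra. }
      assert (HDn : norm D <= h * (F + 2 * eta)).
      { assert (A := norm_le_minus H D (scal h (f t))).
        rewrite norm_scal_R, Rabs_pos_eq in A by lra; fold F in A; lra. }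
      assert (HRI : h * (g t - eta) <= RInt g t (t + h)).
      { assert (A := Hgd h ltac:(lra)).
        change (Rabs (RInt g t (t + h) - h * g t) <= h * eta) in A.
        apply Rabs_le_between in A; lra. }
      assert (Hun : norm (u (t + h)) ^ 2 =
        norm (SG h (u t)) ^ 2 + 2 * inner (SG h (u t)) D + norm D ^ 2).
      { rewrite (Hmild t (t + h)) by lra; replace (t + h - t) with h by ring.
        apply (norm_plus_sqr H inner Hinner). }
      assert (HSn : norm (SG h (u t)) ^ 2 <= N ^ 2).
      { apply pow_incr; split; [apply norm_ge_0|apply SG_norm; lra]. }
      (* Split into <S(h) u - u, D> + <u, D - h f> + h <u, f>, all at time t. *)
      assert (Hin : inner (SG h (u t)) D <=
        eta * norm D + h * g t + N * (h * (2 * eta))).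
      { assert (A1 := inner_le_norm H inner Hinner (minus (SG h (u t)) (u t)) D).
        assert (A2 := inner_le_norm H inner Hinner (u t) (minus D (scal h (f t)))).
        rewrite (inner_minus_l H inner Hinner) in A1.
        rewrite (inner_minus_r H inner Hinner), (inner_scal_r H inner Hinner),
          (inner_sym _ _ Hinner (u t) (f t)) in A2.
        fold N in A2; change (inner (f t) (u t)) with (g t) in A2.
        assert (A3 := Hus h ltac:(lra)).
        assert (A4 : norm (minus (SG h (u t)) (u t)) * norm D <= eta * norm D)
          by (apply Rmult_le_compat_r; [apply norm_ge_0|lra]).
        assert (A5 : N * norm (minus D (scal h (f t))) <= N * (h * (2 * eta)))
          by (now apply Rmult_le_compat_l).
        lra. }
      assert (HD1 : norm D <= h * (F + 2)) by nra.
      assert (HD2 : norm D ^ 2 <= h * eta * (F + 2) ^ 2).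
      { apply Rle_trans with ((h * (F + 2)) ^ 2).
        - apply pow_incr; split; [apply norm_ge_0|easy].
        - replace ((h * (F + 2)) ^ 2) with (h * h * (F + 2) ^ 2) by ring.
          apply Rmult_le_compat_r; [apply pow2_ge_0|nra]. }
      assert (HD3 : eta * norm D <= eta * (h * (F + 2)))
        by (apply Rmult_le_compat_l; lra).
      unfold phi; rewrite Hun; fold N.
      assert (Hch : RInt g a (t + h) = RInt g a t + RInt g t (t + h)).
      { symmetry; apply (RInt_Chasles g a t (t + h)); apply Hgi. }
      rewrite Hch.
      assert (HCh : h * eta * C <= h * eps) by nra.
      unfold C in HCh; lra. }
  unfold phi in Hphi.
  assert (Hz : RInt g a a = 0) by exact (RInt_point a g).
  rewrite Hz in Hphi; lra.
Qed.

End Semigroup.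

(** * Picard iteration on the half-line *)

Lemma half_pow_small (c eps : R) : 0 < eps ->
  exists n, c * (/ 2) ^ n < eps.
Proof.
  intros Heps.
  destruct (pow_lt_1_zero (/ 2)) with (y := eps / (Rabs c + 1)) as [n Hn].
  - rewrite Rabs_pos_eq; lra.
  - apply Rdiv_lt_0_compat; [easy|]; assert (A := Rabs_pos c); lra.
  - exists n; specialize (Hn n (le_n n)).
    assert (Hp : 0 < (/ 2) ^ n) by (apply pow_lt; lra).
    rewrite Rabs_pos_eq in Hn by lra.
    assert (Hc := Rabs_pos c); assert (Hc' := Rle_abs c).
    apply Rmult_lt_compat_l with (r := Rabs c + 1) in Hn; [|lra].
    replace ((Rabs c + 1) * (eps / (Rabs c + 1))) with eps in Hn by (field; lra).
    nra.
Qed.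

Lemma le_half_pow_nonpos (x c : R) : (forall n, x <= c * (/ 2) ^ n) -> x <= 0.
Proof.
  intros Hx; apply Rnot_lt_le; intros Hlt.
  destruct (half_pow_small c x Hlt) as [n Hn]; specialize (Hx n); lra.
Qed.

Section Limits.
Context (V : CompleteNormedModule R_AbsRing).

Lemma norm_minus_nonpos_eq (x y : V) : norm (minus x y) <= 0 -> x = y.
Proof.
  intros Hn; rewrite <- (minus_plusK V x y).
  assert (Hz : minus x y = zero).
  { apply (@norm_eq_zero R_AbsRing V), Rle_antisym; [easy|apply norm_ge_0]. }
  rewrite Hz; exact (plus_zero_l y).
Qed.

Lemma lim_half_pow (w : nat -> V) (c : R) (n : nat) :
  (forall m, norm (minus (w (S m)) (w m)) <= c * (/ 2) ^ m) ->
  norm (minus (w n) (lim (filtermap w eventually))) <= 2 * c * (/ 2) ^ n.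
Proof.
  intros Hw.
  assert (Hc : 0 <= c).
  { specialize (Hw O); simpl in Hw.
    assert (A : 0 <= norm (minus (w 1%nat) (w O))) by apply norm_ge_0; lra. }
  assert (Hp : forall m, 0 < (/ 2) ^ m) by (intros m; apply pow_lt; lra).
  (* The exact geometric sum is kept, since the cruder tail bound would not survive the induction on
     p. *)
  assert (Hstep : forall m p, norm (minus (w m) (w (m + p)%nat)) <=
    2 * c * ((/ 2) ^ m - (/ 2) ^ (m + p))).
  { intros m p; induction p as [|p IH].
    - rewrite Nat.add_0_r, minus_diag, norm_zero_R; lra.
    - eapply Rle_trans; [apply (norm_minus_triangle V _ (w (m + p)%nat))|].
      rewrite (norm_minus_sym V (w (m + p)%nat)).
      specialize (Hw (m + p)%nat); rewrite Nat.add_succ_r; simpl; nra. }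
  assert (Htail : forall m p, (m <= p)%nat ->
    norm (minus (w m) (w p)) <= 2 * c * (/ 2) ^ m).
  { intros m p Hmp; replace p with (m + (p - m))%nat by lia.
    eapply Rle_trans; [apply Hstep|].
    assert (A := Hp (m + (p - m))%nat); nra. }
  assert (Hcauchy : cauchy (filtermap w eventually)).
  { intros eps.
    destruct (half_pow_small (2 * c) eps (cond_pos eps)) as [m Hm].
    exists (w m), m; intros p Hp'.
    apply (@norm_compat1 R_AbsRing V).
    eapply Rle_lt_trans; [|exact Hm].
    eapply Rle_trans; [right; apply (norm_minus_sym V)|now apply Htail]. }
  set (l := lim (filtermap w eventually)).
  assert (Hl := complete_cauchy (filtermap w eventually) _ Hcauchy).
  apply Rnot_lt_le; intros Hlt.
  set (e := norm (minus (w n) l) - 2 * c * (/ 2) ^ n).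
  assert (Hk := @norm_factor_gt_0 R_AbsRing V).
  assert (He : 0 < e / @norm_factor R_AbsRing V)
    by (apply Rdiv_lt_0_compat; unfold e; lra).
  destruct (Hl (mkposreal _ He)) as [m Hm].
  specialize (Hm (n + m)%nat ltac:(lia)).
  apply (@norm_compat2 R_AbsRing V) in Hm; simpl in Hm.
  replace (@norm_factor R_AbsRing V * (e / @norm_factor R_AbsRing V)) with e in Hm
    by (field; lra).
  assert (A := norm_minus_triangle V (w n) (w (n + m)%nat) l).
  assert (A' := Htail n (n + m)%nat ltac:(lia)).
  change (norm (minus (w (n + m)%nat) l) < e) in Hm.
  unfold e in Hm; lra.
Qed.

End Limits.

(** Source of the contraction ratio: integrating [k] times the weight of exponent 2 [k] returns at
    most half the weight. *)
Lemma is_RInt_exp (k C t : R) : 0 < k ->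
  is_RInt (fun s => k * (C * exp (2 * k * s))) 0 t (C / 2 * (exp (2 * k * t) - 1)).
Proof.
  intros Hk.
  replace (C / 2 * (exp (2 * k * t) - 1))
    with (minus (C / 2 * exp (2 * k * t)) (C / 2 * exp (2 * k * 0))).
  - apply (is_RInt_derive (fun s => C / 2 * exp (2 * k * s))).
    + intros s _; auto_derive; [easy|field].
    + intros s _; apply continuity_pt_filterlim; reg.
  - rewrite Rmult_0_r, exp_0; unfold minus, plus, opp; simpl; ring.
Qed.

Section Picard.
Context (H : CompleteNormedModule R_AbsRing) (SG : R -> H -> H)
  (HSG : is_contraction_semigroup H SG).

(** [G] is the whole perturbation, with the factor - lambda included. Clamping freezes the image at
    its initial value for negative times. *)
Definition picard_map (G : H -> H) (z0 : H) (w : R -> H) (t : R) : H :=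
  plus (SG (Rmax 0 t) z0) (duhamel H SG (fun s => G (w s)) 0 (Rmax 0 t)).

Fixpoint picard_iter (G : H -> H) (z0 : H) (n : nat) : R -> H :=
  match n with
  | O => fun _ => zero
  | S m => picard_map G z0 (picard_iter G z0 m)
  end.

Context (G : H -> H) (k : R) (Hk : 0 < k)
  (HG : forall x y, norm (minus (G x) (G y)) <= k * norm (minus x y)).

Lemma lipschitz_comp_continuous (w : R -> H) (t : R) :
  continuous w t -> continuous (fun s => G (w s)) t.
Proof.
  intros Hw; apply continuous_normP; intros eps Heps.
  destruct (proj1 (continuous_normP _ _ _) Hw (eps / k)) as [d [Hd Hwd]];
    [now apply Rdiv_lt_0_compat|].
  exists d; split; [easy|]; intros s Hs.
  eapply Rle_lt_trans; [apply HG|].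
  specialize (Hwd s Hs); apply Rmult_lt_compat_l with (r := k) in Hwd; [|easy].
  replace (k * (eps / k)) with eps in Hwd by (field; lra); easy.
Qed.

Lemma picard_map_continuous (z0 : H) (w : R -> H) (t : R) :
  (forall s, continuous w s) -> continuous (picard_map G z0 w) t.
Proof.
  intros Hw; apply continuous_plus_R.
  - apply (SG_continuous H SG HSG (fun s => s) (fun _ => z0));
      [apply continuous_id|apply continuous_const].
  - apply (duhamel_continuous H SG HSG (fun s => G (w s))).
    intros s; now apply lipschitz_comp_continuous.
Qed.

Lemma picard_map_contraction (z0 : H) (w1 w2 : R -> H) (C t : R) :
  (forall s, continuous w1 s) -> (forall s, continuous w2 s) -> 0 <= C ->
  (forall s, 0 <= s <= t -> norm (minus (w1 s) (w2 s)) <= C * exp (2 * k * s)) ->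
  0 <= t ->
  norm (minus (picard_map G z0 w1 t) (picard_map G z0 w2 t)) <=
    C / 2 * exp (2 * k * t).
Proof.
  intros Hw1 Hw2 HC Hw Ht; unfold picard_map; rewrite Rmax_right by easy.
  assert (HGw : forall w : R -> H, (forall s, continuous w s) ->
    forall s, continuous (fun r => G (w r)) s).
  { intros w Hc s; apply lipschitz_comp_continuous, Hc. }
  rewrite minus_plus_plus, minus_diag.
  eapply Rle_trans; [apply norm_plus_le|].
  rewrite norm_zero_R, Rplus_0_l, (duhamel_minus H SG HSG) by now apply HGw.
  apply Rle_trans with (C / 2 * (exp (2 * k * t) - 1)); [|lra].
  apply (duhamel_norm H SG HSG _ (fun s => k * (C * exp (2 * k * s)))); [easy|..].
  - intros s; apply continuous_minus_R; now apply HGw.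
  - intros s Hs; eapply Rle_trans; [apply HG|].
    apply Rmult_le_compat_l; [lra|now apply Hw].
  - now apply is_RInt_exp.
Qed.

(* The weight [exp (2 k t)] makes the Picard map a contraction of ratio 1/2 on
   the whole half-line. *)
Lemma picard_solution (z0 : H) : G zero = zero ->
  exists z : R -> H, (forall t, continuous z t) /\
    forall t, 0 <= t -> z t = picard_map G z0 z t.
Proof.
  intros HG0; set (w := picard_iter G z0).
  assert (Hw : forall n s, continuous (w n) s).
  { induction n as [|n IH]; intros s; [apply continuous_const|].
    apply picard_map_continuous, IH. }
  assert (Hstep : forall n t, 0 <= t ->
    norm (minus (w (S n) t) (w n t)) <=
      norm z0 * exp (2 * k * t) * (/ 2) ^ n).
  { induction n as [|n IH]; intros t Ht.
    - unfold w; simpl; rewrite minus_zero_R, Rmult_1_r; unfold picard_map.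
      rewrite Rmax_right by easy.
      eapply Rle_trans; [apply norm_plus_le|].
      assert (A1 := SG_norm H SG HSG t z0 Ht).
      assert (A2 : norm (duhamel H SG (fun _ => G zero) 0 t) <= (t - 0) * 0).
      { apply (duhamel_norm H SG HSG _ (fun _ => 0)); [easy|..].
        - intros s; apply continuous_const.
        - intros s _; rewrite HG0, norm_zero_R; lra.
        - exact (is_RInt_const 0 t 0). }
      assert (A3 : 1 <= exp (2 * k * t)).
      { rewrite <- exp_0; destruct (Req_dec t 0) as [->|Hne];
          [right; f_equal; ring|left; apply exp_increasing; nra]. }
      assert (A4 : 0 <= norm z0) by apply norm_ge_0.
      nra.
    - eapply Rle_trans.
      + apply (picard_map_contraction z0 (w (S n)) (w n) (norm z0 * (/ 2) ^ n));
          [apply Hw|apply Hw| |..|easy].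
        * apply Rmult_le_pos; [apply norm_ge_0|apply pow_le; lra].
        * intros s Hs; eapply Rle_trans; [apply IH; lra|right; ring].
      + right; simpl; field. }
  set (z := fun t => lim (filtermap (fun n => w n (Rmax 0 t)) eventually)).
  assert (P : forall r, 0 <= Rmax 0 r) by (intros r; apply Rmax_l).
  assert (Hlim : forall n t, norm (minus (w n (Rmax 0 t)) (z t)) <=
    2 * (norm z0 * exp (2 * k * Rmax 0 t)) * (/ 2) ^ n).
  { intros n t; apply (lim_half_pow H (fun m => w m (Rmax 0 t))).
    intros m; apply Hstep, P. }
  assert (Hmono : forall a b, a <= b -> exp (2 * k * a) <= exp (2 * k * b)).
  { intros a b [Hab| ->]; [left; apply exp_increasing; nra|lra]. }
  assert (Hzc : forall t, continuous z t).
  { intros t; apply continuous_normP; intros eps Heps.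
    (* The weight at clamped time plus 1 dominates all weights near t, so convergence is locally
       uniform and an [eps / 3] argument applies. *)
    set (c := 2 * (norm z0 * exp (2 * k * (Rmax 0 t + 1)))).
    destruct (half_pow_small c (eps / 3)) as [n Hn]; [lra|].
    assert (Hnear : forall s, Rmax 0 s <= Rmax 0 t + 1 ->
      norm (minus (w n (Rmax 0 s)) (z s)) < eps / 3).
    { intros s Hs; eapply Rle_lt_trans; [apply Hlim|].
      eapply Rle_lt_trans; [|exact Hn].
      apply Rmult_le_compat_r; [apply pow_le; lra|]; unfold c.
      apply Rmult_le_compat_l; [lra|].
      apply Rmult_le_compat_l; [apply norm_ge_0|now apply Hmono]. }
    assert (Hwn : continuous (fun s => w n (Rmax 0 s)) t).
    { apply (continuous_comp (fun s => Rmax 0 s) (w n)); [|apply Hw].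
      apply continuous_Rmax; [apply continuous_const|apply continuous_id]. }
    destruct (proj1 (continuous_normP _ _ _) Hwn (eps / 3)) as [d [Hd Hwd]]; [lra|].
    exists (Rmin 1 d); split; [apply Rmin_glb_lt; lra|]; intros s Hs.
    assert (Hs1 : Rabs (s - t) < 1) by (eapply Rlt_le_trans; [exact Hs|apply Rmin_l]).
    assert (Hsd : Rabs (s - t) < d) by (eapply Rlt_le_trans; [exact Hs|apply Rmin_r]).
    specialize (Hwd s Hsd); apply Rabs_def2 in Hs1.
    assert (A1 := Hnear t ltac:(lra)).
    assert (A2 : norm (minus (w n (Rmax 0 s)) (z s)) < eps / 3).
    { apply Hnear; unfold Rmax; destruct (Rle_dec 0 s), (Rle_dec 0 t); lra. }
    assert (A3 := norm_minus_triangle H (z s) (w n (Rmax 0 s)) (z t)).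
    assert (A4 := norm_minus_triangle H (w n (Rmax 0 s)) (w n (Rmax 0 t)) (z t)).
    rewrite (norm_minus_sym H (z s) (w n _)) in A3; lra. }
  exists z; split; [easy|]; intros t Ht.
  apply norm_minus_nonpos_eq.
  apply le_half_pow_nonpos with (2 * (norm z0 * exp (2 * k * t))); intros n.
  (* The iterate w_(n+1) is the Picard image of w_n, so it is close both to the limit and to the
     image of the limit. *)
  assert (A1 := norm_minus_triangle H (z t) (w (S n) t) (picard_map G z0 z t)).
  assert (A2 := Hlim (S n) t); rewrite Rmax_right in A2 by easy.
  rewrite (norm_minus_sym H (w _ _)) in A2.
  assert (A3 : norm (minus (w (S n) t) (picard_map G z0 z t)) <=
    2 * norm z0 * (/ 2) ^ n / 2 * exp (2 * k * t)).
  { apply picard_map_contraction; [apply Hw|apply Hzc| |..|easy].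
    - apply Rmult_le_pos; [|apply pow_le; lra].
      apply Rmult_le_pos; [lra|apply norm_ge_0].
    - intros s Hs; assert (A := Hlim n s); rewrite Rmax_right in A by lra.
      eapply Rle_trans; [exact A|right; ring]. }
  simpl in A2; lra.
Qed.

(** Boundedness of the difference makes its weighted norm finite; each application of the Picard map
    then halves it. *)
Lemma picard_fixpoint_unique (z0 : H) (u1 u2 : R -> H) (C : R) :
  (forall t, continuous u1 t) -> (forall t, continuous u2 t) ->
  (forall t, 0 <= t -> u1 t = picard_map G z0 u1 t) ->
  (forall t, 0 <= t -> u2 t = picard_map G z0 u2 t) ->
  (forall t, 0 <= t -> norm (minus (u1 t) (u2 t)) <= C) ->
  forall t, 0 <= t -> u1 t = u2 t.
Proof.
  intros Hc1 Hc2 H1 H2 HC.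
  assert (HC0 : 0 <= C).
  { apply Rle_trans with (norm (minus (u1 0) (u2 0))); [apply norm_ge_0|apply HC; lra]. }
  assert (Hn : forall n t, 0 <= t ->
    norm (minus (u1 t) (u2 t)) <= C * (/ 2) ^ n * exp (2 * k * t)).
  { induction n as [|n IH]; intros t Ht.
    - eapply Rle_trans; [now apply HC|]; simpl.
      assert (A3 : 1 <= exp (2 * k * t)).
      { rewrite <- exp_0; destruct (Req_dec t 0) as [->|Hne];
          [right; f_equal; ring|left; apply exp_increasing; nra]. }
      nra.
    - rewrite H1, H2 by easy.
      eapply Rle_trans.
      + apply (picard_map_contraction z0 u1 u2 (C * (/ 2) ^ n)); try easy.
        * apply Rmult_le_pos; [easy|apply pow_le; lra].
        * intros s Hs; apply IH; lra.
      + right; simpl; field. }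
  intros t Ht; apply norm_minus_nonpos_eq.
  apply le_half_pow_nonpos with (C * exp (2 * k * t)); intros n.
  eapply Rle_trans; [now apply (Hn n)|right; ring].
Qed.

End Picard.

(** * Truncation by radial projection onto a ball *)

Section RadialProjection.
Context (H : CompleteNormedModule R_AbsRing) (R0 : R) (HR0 : 0 < R0).

Definition radial_proj (x : H) : H := scal (R0 / Rmax R0 (norm x)) x.

Lemma radial_factor_bounds (x : H) :
  0 < R0 / Rmax R0 (norm x) <= 1 /\ R0 / Rmax R0 (norm x) * norm x <= R0.
Proof.
  assert (Hm := Rmax_l R0 (norm x)); assert (Hm' := Rmax_r R0 (norm x)).
  assert (Hi : 0 < / Rmax R0 (norm x)) by (apply Rinv_0_lt_compat; lra).
  assert (Hii : / Rmax R0 (norm x) * Rmax R0 (norm x) = 1) by (field; lra).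
  assert (Hx : 0 <= norm x) by apply norm_ge_0.
  assert (Hin : / Rmax R0 (norm x) * norm x <= 1).
  { rewrite <- Hii; apply Rmult_le_compat_l; lra. }
  unfold Rdiv; repeat split; [nra|nra|].
  rewrite Rmult_assoc; nra.
Qed.

Lemma radial_proj_norm (x : H) : norm (radial_proj x) <= R0.
Proof.
  destruct (radial_factor_bounds x) as [Hf Hle].
  unfold radial_proj; rewrite norm_scal_R, Rabs_pos_eq; lra.
Qed.

Lemma radial_proj_id (x : H) : norm x <= R0 -> radial_proj x = x.
Proof.
  intros Hx; unfold radial_proj; rewrite Rmax_left by easy.
  replace (R0 / R0) with 1 by (field; lra); apply scal_1_R.
Qed.

Lemma radial_proj_ray (x : H) :
  exists c, 0 <= c /\ x = scal c (radial_proj x).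
Proof.
  assert (Hm := Rmax_l R0 (norm x)).
  exists (Rmax R0 (norm x) / R0); split.
  - left; apply Rdiv_lt_0_compat; lra.
  - unfold radial_proj; rewrite scal_scal_R.
    replace (Rmax R0 (norm x) / R0 * (R0 / Rmax R0 (norm x))) with 1 by (field; lra).
    symmetry; apply scal_1_R.
Qed.

(** Decompose the difference as [cx] (x - y) + ([cx] - [cy]) y. The second term costs at most
    another |x - y|, because x -> max(R0, |x|) is 1-Lipschitz and |y| <= max(R0, |y|). *)
Lemma radial_proj_lipschitz (x y : H) :
  norm (minus (radial_proj x) (radial_proj y)) <= 2 * norm (minus x y).
Proof.
  set (cx := R0 / Rmax R0 (norm x)); set (cy := R0 / Rmax R0 (norm y)).
  destruct (radial_factor_bounds x) as [Hcx _]; fold cx in Hcx.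
  assert (Hdec : minus (radial_proj x) (radial_proj y) =
    plus (scal cx (minus x y)) (scal (cx - cy) y)).
  { assert (E1 : scal cx (minus x y) = minus (scal cx x) (scal cx y))
      by exact (scal_minus_R H cx x y).
    assert (E2 : scal (cx - cy) y = minus (scal cx y) (scal cy y))
      by exact (scal_minus_distr_r cx cy y).
    rewrite E1, E2; symmetry; exact (minus_chain H (scal cx x) (scal cx y) (scal cy y)). }
  rewrite Hdec.
  eapply Rle_trans; [apply norm_plus_le|].
  rewrite !norm_scal_R, (Rabs_pos_eq cx) by lra.
  assert (Hn : 0 <= norm (minus x y)) by apply norm_ge_0.
  assert (Habs := Rabs_norm_minus H x y).
  assert (Hmx := Rmax_l R0 (norm x)); assert (Hmy := Rmax_l R0 (norm y)).
  assert (Hmy' := Rmax_r R0 (norm y)).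
  assert (Hcxy : cx - cy =
    cx * / Rmax R0 (norm y) * (Rmax R0 (norm y) - Rmax R0 (norm x))).
  { unfold cx, cy; field; lra. }
  assert (Hmax : Rabs (Rmax R0 (norm y) - Rmax R0 (norm x)) <= norm (minus x y)).
  { apply Rabs_le_between in Habs; apply Rabs_le; unfold Rmax.
    destruct (Rle_dec R0 (norm x)), (Rle_dec R0 (norm y)); lra. }
  assert (Hi : 0 < / Rmax R0 (norm y)) by (apply Rinv_0_lt_compat; lra).
  assert (Hy : / Rmax R0 (norm y) * norm y <= 1).
  { apply Rmult_le_reg_l with (Rmax R0 (norm y)); [lra|].
    rewrite <- Rmult_assoc, Rinv_r; lra. }
  assert (Hy0 : 0 <= norm y) by apply norm_ge_0.
  rewrite Hcxy, Rabs_mult, (Rabs_pos_eq (cx * _)) by (apply Rmult_le_pos; lra).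
  assert (A1 : cx * norm (minus x y) <= norm (minus x y)) by nra.
  assert (A2 : cx * (/ Rmax R0 (norm y) * norm y) <= 1).
  { assert (0 <= / Rmax R0 (norm y) * norm y) by (apply Rmult_le_pos; lra); nra. }
  assert (A3 : 0 <= cx * (/ Rmax R0 (norm y) * norm y)).
  { apply Rmult_le_pos; [lra|apply Rmult_le_pos; lra]. }
  replace (cx * / Rmax R0 (norm y) * Rabs (Rmax R0 (norm y) - Rmax R0 (norm x)) * norm y)
    with (cx * (/ Rmax R0 (norm y) * norm y) * Rabs (Rmax R0 (norm y) - Rmax R0 (norm x)))
    by ring.
  assert (A4 := Rabs_pos (Rmax R0 (norm y) - Rmax R0 (norm x))).
  nra.
Qed.

End RadialProjection.

(** * Exponential stabilization *)

(** With m the integer part of t / T, m > t / T - 1 gives q^m <= q^(t/T - 1), the square of the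
    announced factor. The prefactor q^(-1/2) pays for the incomplete last period. *)
Lemma geometric_decay_exponential (n : R -> R) (q T : R) :
  0 < q < 1 -> 0 < T ->
  (forall t, 0 <= t -> 0 <= n t) ->
  (forall s t, 0 <= s <= t -> n t <= n s) ->
  (forall s, 0 <= s -> n (s + T) ^ 2 <= q * n s ^ 2) ->
  forall t, 0 <= t ->
    n t <= exp (- ln q / 2) * exp (- (- ln q / (2 * T)) * t) * n 0.
Proof.
  intros Hq HT Hpos Hmono Hstep t Ht.
  assert (Hiter : forall m, n (INR m * T) ^ 2 <= q ^ m * n 0 ^ 2).
  { induction m as [|m IH].
    - simpl INR; rewrite Rmult_0_l; simpl; lra.
    - rewrite S_INR; replace ((INR m + 1) * T) with (INR m * T + T) by ring.
      eapply Rle_trans; [apply Hstep|].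
      + apply Rmult_le_pos; [apply pos_INR|lra].
      + simpl (q ^ S m); rewrite Rmult_assoc.
        apply Rmult_le_compat_l; [lra|easy]. }
  destruct (nfloor_ex (t / T)) as [m [Hm1 Hm2]];
    [apply Rmult_le_pos; [easy|left; now apply Rinv_0_lt_compat]|].
  assert (HtT : t / T * T = t) by (field; lra).
  assert (HmT : 0 <= INR m * T) by (apply Rmult_le_pos; [apply pos_INR|lra]).
  assert (Hln : ln q < 0) by (rewrite <- ln_1; apply ln_increasing; lra).
  assert (Hsq : n t ^ 2 <= q ^ m * n 0 ^ 2).
  { eapply Rle_trans; [|apply Hiter].
    apply pow_incr; split; [now apply Hpos|apply Hmono; nra]. }
  assert (Hqm : q ^ m <= (exp (- ln q / 2) * exp (- (- ln q / (2 * T)) * t)) ^ 2).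
  { rewrite <- exp_plus, <- (exp_ln q) at 1 by lra.
    assert (Hpow : forall x j, exp x ^ j = exp (INR j * x)).
    { intros x j; induction j as [|j IH].
      - simpl; now rewrite Rmult_0_l, exp_0.
      - rewrite S_INR, <- tech_pow_Rmult, IH, <- exp_plus; f_equal; ring. }
    rewrite !Hpow.
    replace (INR 2 * (- ln q / 2 + - (- ln q / (2 * T)) * t))
      with ((t / T - 1) * ln q) by (simpl; field; lra).
    assert (Hle : INR m * ln q <= (t / T - 1) * ln q) by nra.
    destruct Hle as [Hlt|Heq]; [left; now apply exp_increasing|rewrite Heq; lra]. }
  apply Rnot_lt_le; intros Hlt.
  set (c := exp (- ln q / 2) * exp (- (- ln q / (2 * T)) * t)) in *.
  assert (Hc : 0 < c) by (apply Rmult_lt_0_compat; apply exp_pos).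
  assert (Hn0 := Hpos 0 (Rle_refl 0)).
  assert (Hcn : 0 <= c * n 0) by (apply Rmult_le_pos; lra).
  assert (A : q ^ m * n 0 ^ 2 <= c ^ 2 * n 0 ^ 2)
    by (apply Rmult_le_compat_r; [apply pow2_ge_0|easy]).
  nra.
Qed.

Section Stabilization.
Context (H : CompleteNormedModule R_AbsRing) (SG : R -> H -> H)
  (HSG : is_contraction_semigroup H SG)
  (inner : H -> H -> R) (Hinner : is_inner_product H inner).

Lemma duhamel_scal (f : R -> H) (c a b : R) : (forall s, continuous f s) ->
  duhamel H SG (fun s => scal c (f s)) a b = scal c (duhamel H SG f a b).
Proof.
  intros Hf; unfold duhamel; rewrite <- RInt_scal.
  - apply RInt_ext; intros s _; apply (SG_scal H SG HSG), Rmax_l.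
  - apply ex_RInt_cont; intros t; now apply duhamel_integrand_continuous.
Qed.

Lemma locally_lipschitz_comp_continuous (B : H -> H) (w : R -> H) (t : R) :
  lipschitz_on_bounded_subsets H B -> continuous w t ->
  continuous (fun s => B (w s)) t.
Proof.
  intros HB Hw; apply continuous_normP; intros eps Heps.
  destruct (HB (fun x => norm x <= norm (w t) + 1)) as [L HL];
    [now exists (norm (w t) + 1)|].
  (* The Lipschitz constant comes without a sign, hence the positive substitute [Rabs L + 1]. *)
  assert (HL0 : L <= Rabs L) by apply Rle_abs; assert (HL1 := Rabs_pos L).
  destruct (proj1 (continuous_normP _ _ _) Hw (Rmin 1 (eps / (Rabs L + 1))))
    as [d [Hd Hwd]]; [apply Rmin_glb_lt; [lra|apply Rdiv_lt_0_compat; lra]|].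
  exists d; split; [easy|]; intros s Hs; specialize (Hwd s Hs).
  assert (Hw1 : norm (minus (w s) (w t)) < 1)
    by (eapply Rlt_le_trans; [exact Hwd|apply Rmin_l]).
  assert (Hw2 : norm (minus (w s) (w t)) < eps / (Rabs L + 1))
    by (eapply Rlt_le_trans; [exact Hwd|apply Rmin_r]).
  eapply Rle_lt_trans; [apply HL|].
  - assert (A := norm_le_minus H (w s) (w t)); lra.
  - lra.
  - apply Rmult_lt_compat_l with (r := Rabs L + 1) in Hw2; [|lra].
    replace ((Rabs L + 1) * (eps / (Rabs L + 1))) with eps in Hw2 by (field; lra).
    assert (A : 0 <= norm (minus (w s) (w t))) by apply norm_ge_0; nra.
Qed.

(* A mild solution on [[0, +oo)] together with a continuous extension to negative
   times. *)
Definition clamped_mild (B : H -> H) (lambda : R) (z0 : H) (z : R -> H) : Prop :=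
  (forall t, continuous z t) /\
  forall t, 0 <= t ->
    z t = picard_map H SG (fun x => scal (- lambda) (B x)) z0 z t.

Section Trajectory.
Context (B : H -> H) (HBpos : forall x, 0 <= inner (B x) x)
  (HBc : forall (w : R -> H) (t : R), continuous w t -> continuous (fun s => B (w s)) t)
  (lambda : R) (Hlambda : 0 < lambda).

(** The two formulas differ by the place of the factor lambda and by a clamp that is invisible for 0
    < s < t. *)
Lemma is_mild_solutionP (z0 : H) (z : R -> H) :
  (forall t, continuous z t) ->
  (forall t, 0 <= t ->
     z t = minus (SG t z0) (scal lambda (RInt (fun s => SG (t - s) (B (z s))) 0 t))) <->
  (forall t, 0 <= t ->
     z t = picard_map H SG (fun x => scal (- lambda) (B x)) z0 z t).
Proof.
  intros Hz.
  assert (Heq : forall t, 0 <= t ->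
    picard_map H SG (fun x => scal (- lambda) (B x)) z0 z t =
    minus (SG t z0) (scal lambda (RInt (fun s => SG (t - s) (B (z s))) 0 t))).
  { intros t Ht; unfold picard_map; rewrite Rmax_right by easy.
    rewrite (duhamel_scal (fun s => B (z s))) by (intros s; apply HBc, Hz).
    assert (Hdu : duhamel H SG (fun s => B (z s)) 0 t =
      RInt (fun s => SG (t - s) (B (z s))) 0 t).
    { apply RInt_ext; rewrite Rmin_left, Rmax_right by easy; intros s Hs.
      now rewrite Rmax_right by lra. }
    rewrite Hdu, <- plus_opp_minus, opp_scal_R, scal_scal_R; do 2 f_equal; ring. }
  split; intros Hm t Ht; [rewrite Heq by easy|rewrite <- Heq by easy]; now apply Hm.
Qed.

Lemma clamped_mild_restart (z0 : H) (z : R -> H) (s t : R) :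
  clamped_mild B lambda z0 z -> 0 <= s <= t ->
  z t = plus (SG (t - s) (z s))
          (duhamel H SG (fun r => scal (- lambda) (B (z r))) s t).
Proof.
  intros [Hz Hm] Hst.
  set (f := fun r => scal (- lambda) (B (z r))).
  assert (Hf : forall r, continuous f r).
  { intros r; exact (@continuous_scal_r R_UniformSpace R_AbsRing H (- lambda)
      (fun r => B (z r)) r (HBc z r (Hz r))). }
  rewrite (Hm t), (Hm s) by lra; unfold picard_map; fold f.
  rewrite !Rmax_right by lra.
  rewrite (duhamel_split H SG HSG f 0 s t) by easy.
  rewrite (SG_plus H SG HSG), <- (SG_add H SG HSG) by lra.
  replace (t - s + s) with t by ring.
  exact (plus_assoc (SG t z0) _ _).
Qed.

Lemma clamped_mild_energy (z0 : H) (z : R -> H) (a b : R) :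
  clamped_mild B lambda z0 z -> 0 <= a <= b ->
  norm (z b) ^ 2 + 2 * lambda * RInt (fun s => inner (B (z s)) (z s)) a b <=
    norm (z a) ^ 2.
Proof.
  intros Hcm Hab; assert (Hz := proj1 Hcm).
  set (g := fun s => inner (B (z s)) (z s)).
  assert (Hg : forall s, continuous g s).
  { intros s; apply (continuous_inner H inner Hinner); [apply HBc|]; apply Hz. }
  assert (He : norm (z b) ^ 2 <= norm (z a) ^ 2 +
    2 * RInt (fun s => inner (scal (- lambda) (B (z s))) (z s)) a b).
  { apply (mild_energy H SG HSG inner Hinner z (fun r => scal (- lambda) (B (z r))));
      [easy| | |lra].
    - intros r; exact (@continuous_scal_r R_UniformSpace R_AbsRing H (- lambda)
        (fun r => B (z r)) r (HBc z r (Hz r))).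
    - intros s t Hst; apply (clamped_mild_restart z0); [easy|lra]. }
  assert (Hi : RInt (fun s => inner (scal (- lambda) (B (z s))) (z s)) a b =
    - lambda * RInt g a b).
  { rewrite (RInt_ext _ (fun s => scal (- lambda) (g s))).
    - apply (RInt_scal g a b (- lambda)).
      apply (ex_RInt_cont R_CompleteNormedModule g), Hg.
    - intros s _; apply (inner_scal_l _ _ Hinner). }
  rewrite Hi in He; lra.
Qed.

Lemma clamped_mild_nonincreasing (z0 : H) (z : R -> H) (a b : R) :
  clamped_mild B lambda z0 z -> 0 <= a <= b -> norm (z b) <= norm (z a).
Proof.
  intros Hcm Hab; assert (Hz := proj1 Hcm).
  assert (He := clamped_mild_energy z0 z a b Hcm Hab).
  assert (Hi : 0 <= RInt (fun s => inner (B (z s)) (z s)) a b).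
  { apply RInt_ge_0; [lra| |intros; apply HBpos].
    apply (ex_RInt_cont R_CompleteNormedModule (fun s => inner (B (z s)) (z s))).
    intros s; apply (continuous_inner H inner Hinner); [apply HBc|]; apply Hz. }
  apply Rnot_lt_le; intros Hlt.
  assert (Hn : 0 <= norm (z a)) by apply norm_ge_0.
  assert (0 <= lambda * RInt (fun s => inner (B (z s)) (z s)) a b)
    by (apply Rmult_le_pos; lra).
  nra.
Qed.

Lemma clamped_mild_init (z0 : H) (z : R -> H) :
  clamped_mild B lambda z0 z -> z 0 = z0.
Proof.
  intros [_ Hm]; rewrite (Hm 0) by lra; unfold picard_map.
  rewrite Rmax_left, (SG_0 H SG HSG) by lra; unfold duhamel.
  rewrite RInt_point; exact (plus_zero_r z0).
Qed.

Lemma clamped_mild_norm_le (z0 : H) (z : R -> H) (t : R) :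
  clamped_mild B lambda z0 z -> 0 <= t -> norm (z t) <= norm z0.
Proof.
  intros Hcm Ht; rewrite <- (clamped_mild_init z0 z Hcm).
  apply (clamped_mild_nonincreasing z0); [easy|lra].
Qed.

Lemma clamped_mild_period_decay (z0 : H) (z : R -> H) (R0 L T delta s : R) :
  clamped_mild B lambda z0 z -> norm z0 <= R0 -> 0 <= L ->
  (forall x, norm x <= R0 -> norm (B x) <= L * norm x) ->
  (forall x y, norm x <= R0 -> norm y <= R0 ->
     norm (minus (B x) (B y)) <= L * norm (minus x y)) ->
  0 < T ->
  (forall y, RInt (fun t => Rabs (inner (B (SG t y)) (SG t y))) 0 T
     >= delta * norm y ^ 2) ->
  0 <= s ->
  norm (z (s + T)) ^ 2 <=
    (1 - 2 * lambda * (delta - 2 * lambda * L ^ 2 * T ^ 2)) * norm (z s) ^ 2.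
Proof.
  intros Hcm Hz0 HL HBb HBl HT Hobs Hs; assert (Hz := proj1 Hcm).
  set (y := z s); set (N := norm y).
  assert (HN : 0 <= N) by apply norm_ge_0.
  assert (HNR : N <= R0).
  { eapply Rle_trans; [now apply (clamped_mild_norm_le z0)|easy]. }
  assert (HzN : forall r, s <= r -> norm (z r) <= N).
  { intros r Hr; apply (clamped_mild_nonincreasing z0); [easy|lra]. }
  set (g := fun r => inner (B (z r)) (z r)).
  assert (Hg : forall r, continuous g r).
  { intros r; apply (continuous_inner H inner Hinner); [apply HBc|]; apply Hz. }
  (* Twice L N |x - v| with |x - v| <= lambda L N T: one share for each error term in [Hsplit]. *)
  set (K := 2 * L ^ 2 * lambda * T * N ^ 2).
  assert (Hpt : forall t, 0 < t < T ->
    Rabs (inner (B (SG t y)) (SG t y)) <= g (t + s) + K).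
  { intros t Ht.
    rewrite Rabs_pos_eq by apply HBpos; unfold g.
    set (x := SG t y); set (v := z (t + s)).
    assert (Hx : norm x <= N) by (apply (SG_norm H SG HSG); lra).
    assert (Hv : norm v <= N) by (apply HzN; lra).
    assert (Hd : norm (minus x v) <= lambda * L * N * T).
    { unfold v; rewrite (clamped_mild_restart z0 z s (t + s)) by (easy || lra).
      replace (t + s - s) with t by ring; fold y x.
      rewrite norm_minus_sym, plus_minusK.
      apply Rle_trans with ((t + s - s) * (lambda * (L * N))).
      - apply (duhamel_norm H SG HSG _ (fun _ => lambda * (L * N))); [lra|..].
        + intros r; exact (@continuous_scal_r R_UniformSpace R_AbsRing H (- lambda)
            (fun r => B (z r)) r (HBc z r (Hz r))).
        + intros r Hr; rewrite norm_scal_R, Rabs_Ropp, Rabs_pos_eq by lra.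
          apply Rmult_le_compat_l; [lra|].
          assert (Hzr : norm (z r) <= N) by (apply HzN; lra).
          eapply Rle_trans; [apply HBb; lra|apply Rmult_le_compat_l; lra].
        + exact (is_RInt_const s (t + s) (lambda * (L * N))).
      - replace (lambda * L * N * T) with (T * (lambda * (L * N))) by ring.
        apply Rmult_le_compat_r; [|lra].
        repeat apply Rmult_le_pos; lra. }
    assert (Hd0 : 0 <= norm (minus x v)) by apply norm_ge_0.
    assert (Hsplit : inner (B x) x =
      inner (B v) v + inner (minus (B x) (B v)) x + inner (B v) (minus x v)).
    { rewrite (inner_minus_l H inner Hinner), (inner_minus_r H inner Hinner); ring. }
    assert (A1 := inner_le_norm H inner Hinner (minus (B x) (B v)) x).
    assert (A2 := inner_le_norm H inner Hinner (B v) (minus x v)).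
    assert (B1 : norm (minus (B x) (B v)) <= L * norm (minus x v)) by (apply HBl; lra).
    assert (B2 : norm (B v) <= L * N).
    { eapply Rle_trans; [apply HBb; lra|apply Rmult_le_compat_l; lra]. }
    assert (C1 : norm (minus (B x) (B v)) * norm x <= L * (lambda * L * N * T) * N).
    { apply Rmult_le_compat; try apply norm_ge_0; [|easy].
      eapply Rle_trans; [exact B1|apply Rmult_le_compat_l; easy]. }
    assert (C2 : norm (B v) * norm (minus x v) <= L * N * (lambda * L * N * T)).
    { apply Rmult_le_compat; try apply norm_ge_0; easy. }
    unfold K; rewrite Hsplit; nra. }
  assert (HSy : forall t, continuous (fun t => SG (Rmax 0 t) y) t).
  { intros t; apply (SG_continuous H SG HSG (fun s => s) (fun _ => y));
      [apply continuous_id|apply continuous_const]. }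
  assert (Hint : RInt (fun t => Rabs (inner (B (SG t y)) (SG t y))) 0 T <=
    RInt (fun t => g (t + s) + K) 0 T).
  { apply RInt_le; [lra|..|exact Hpt].
    (* The free orbit may be meaningless at negative times, so integrability is proved for its
       clamped version. *)
    - apply ex_RInt_ext with
        (fun t => Rabs (inner (B (SG (Rmax 0 t) y)) (SG (Rmax 0 t) y))).
      + rewrite Rmin_left, Rmax_right by lra; intros t Ht.
        now rewrite Rmax_right by lra.
      + apply (ex_RInt_cont R_CompleteNormedModule
          (fun t => Rabs (inner (B (SG (Rmax 0 t) y)) (SG (Rmax 0 t) y)))).
        intros t; apply continuous_Rabs_comp.
        apply (continuous_inner H inner Hinner); [apply (HBc (fun t => SG (Rmax 0 t) y))|];
          apply HSy.
    - apply (ex_RInt_cont R_CompleteNormedModule (fun t => g (t + s) + K)).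
      intros t; apply (continuous_plus (fun t => g (t + s)) (fun _ => K));
        [|apply continuous_const].
      apply (continuous_comp (fun t => t + s) g); [|apply Hg].
      apply (continuous_plus (fun t => t) (fun _ => s));
        [apply continuous_id|apply continuous_const]. }
  assert (Hval : RInt (fun t => g (t + s) + K) 0 T = RInt g s (s + T) + T * K).
  { apply is_RInt_unique, (is_RInt_plus (fun t => g (t + s)) (fun _ => K)).
    - apply is_RInt_ext with (fun t => scal 1 (g (1 * t + s))).
      + intros t _; transitivity (g (1 * t + s)); [apply Rmult_1_l|f_equal; ring].
      + apply (is_RInt_comp_lin g 1 s 0 T).
        replace (1 * 0 + s) with s by ring; replace (1 * T + s) with (s + T) by ring.
        apply (RInt_correct g), (ex_RInt_cont R_CompleteNormedModule g), Hg.
    - replace (T * K) with (scal (T - 0) K) by (unfold scal; simpl; unfold mult; simpl; ring).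
      apply (is_RInt_const 0 T K). }
  assert (He := clamped_mild_energy z0 z s (s + T) Hcm ltac:(lra)).
  fold g in He; fold y N in He.
  specialize (Hobs y); fold N in Hobs; rewrite Hval in Hint.
  assert (Hfin : 2 * lambda * (delta * N ^ 2 - T * K) <= 2 * lambda * RInt g s (s + T))
    by (apply Rmult_le_compat_l; lra).
  unfold K in Hfin; fold y N; lra.
Qed.

End Trajectory.

(** * Well-posedness of the closed-loop equation *)

Lemma picard_map_ext (G1 G2 : H -> H) (z0 : H) (w1 w2 : R -> H) (t : R) :
  (forall s, 0 <= s -> G1 (w1 s) = G2 (w2 s)) -> 0 <= t ->
  picard_map H SG G1 z0 w1 t = picard_map H SG G2 z0 w2 t.
Proof.
  intros HG Ht; unfold picard_map; f_equal.
  apply RInt_ext; rewrite Rmax_right, Rmin_left, Rmax_right by easy.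
  intros s Hs; now rewrite HG by lra.
Qed.

(** Clamped times always lie in the half-line, so continuity relative to it becomes two-sided. *)
Lemma clamp_continuous (z : R -> H) (t : R) :
  continuous_on (fun t => 0 <= t) z -> continuous (fun s => z (Rmax 0 s)) t.
Proof.
  intros Hz P HP.
  assert (Hm : continuous (fun s => Rmax 0 s) t).
  { apply continuous_Rmax; [apply continuous_const|apply continuous_id]. }
  assert (HzP := Hz (Rmax 0 t) (Rmax_l _ _) P HP).
  assert (Hloc : locally t (fun s => 0 <= Rmax 0 s -> P (z (Rmax 0 s)))) by exact (Hm _ HzP).
  eapply (filter_imp (F := locally t)); [|exact Hloc].
  intros s Hs; apply Hs, Rmax_l.
Qed.

Lemma is_mild_solution_clamped (B : H -> H) (lambda : R) (z0 : H) (z : R -> H) :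
  (forall (w : R -> H) (t : R), continuous w t -> continuous (fun s => B (w s)) t) ->
  is_mild_solution H SG B lambda z0 z ->
  clamped_mild B lambda z0 (fun t => z (Rmax 0 t)).
Proof.
  intros HBc [Hzc Hz].
  assert (Hc : forall t, continuous (fun s => z (Rmax 0 s)) t)
    by (intros t; now apply clamp_continuous).
  split; [easy|].
  apply (is_mild_solutionP B HBc lambda z0 (fun t => z (Rmax 0 t)) Hc).
  intros t Ht; rewrite Rmax_right, (Hz t) by easy; do 2 f_equal.
  apply RInt_ext; rewrite Rmin_left, Rmax_right by easy.
  intros s Hs; now rewrite Rmax_right by lra.
Qed.

Lemma clamped_mild_is_solution (B : H -> H) (lambda : R) (z0 : H) (z : R -> H) :
  (forall (w : R -> H) (t : R), continuous w t -> continuous (fun s => B (w s)) t) ->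
  clamped_mild B lambda z0 z -> is_mild_solution H SG B lambda z0 z.
Proof.
  intros HBc [Hzc Hz]; split.
  - intros t _ P HP.
    assert (Hloc : locally t (fun s => P (z s))) by exact (Hzc t P HP).
    eapply (filter_imp (F := locally t)); [|exact Hloc]; now intros s Hs _.
  - now apply (is_mild_solutionP B HBc lambda z0 z Hzc).
Qed.

(* Positivity survives the truncation because [x] is a nonnegative multiple of
   its radial projection, so truncated trajectories never leave the ball and
   solve the original equation. *)
Lemma mild_solution_exists_unique (B : H -> H) (lambda L R0 : R) (z0 : H) :
  B zero = zero -> (forall x, 0 <= inner (B x) x) ->
  lipschitz_on_bounded_subsets H B -> 0 < lambda -> 0 < L -> 0 < R0 ->
  (forall x y, norm x <= R0 -> norm y <= R0 ->
     norm (minus (B x) (B y)) <= L * norm (minus x y)) ->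
  norm z0 <= R0 ->
  exists z, clamped_mild B lambda z0 z /\
    forall z', is_mild_solution H SG B lambda z0 z' ->
      forall t, 0 <= t -> z' t = z t.
Proof.
  intros HB0 HBpos HBlip Hl HL HR0 HBl Hz0.
  assert (HBc : forall (w : R -> H) t, continuous w t -> continuous (fun s => B (w s)) t)
    by (intros w t; now apply locally_lipschitz_comp_continuous).
  set (F := fun x => B (radial_proj H R0 x)).
  (* Positivity and preservation of continuity are all that the a priori norm bound asks of [F]. *)
  assert (HFpos : forall x, 0 <= inner (F x) x).
  { intros x; destruct (radial_proj_ray H R0 HR0 x) as [c [Hc Hx]].
    rewrite Hx at 2; rewrite (inner_scal_r H inner Hinner).
    apply Rmult_le_pos; [easy|apply HBpos]. }
  assert (HFc : forall (w : R -> H) t, continuous w t -> continuous (fun s => F (w s)) t).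
  { intros w t Hw; apply (HBc (fun s => radial_proj H R0 (w s))).
    apply (lipschitz_comp_continuous H (radial_proj H R0) 2); [lra| |easy].
    now apply radial_proj_lipschitz. }
  assert (HF0 : F zero = zero).
  { unfold F; rewrite radial_proj_id; [easy|easy|rewrite norm_zero_R; lra]. }
  set (G := fun x => scal (- lambda) (F x)).
  assert (HG : forall x y, norm (minus (G x) (G y)) <= lambda * (L * 2) * norm (minus x y)).
  { intros x y; unfold G; rewrite <- scal_minus_R, norm_scal_R.
    rewrite Rabs_Ropp, Rabs_pos_eq, Rmult_assoc by lra.
    apply Rmult_le_compat_l; [lra|].
    eapply Rle_trans; [apply HBl; now apply radial_proj_norm|].
    rewrite Rmult_assoc; apply Rmult_le_compat_l; [lra|].
    now apply radial_proj_lipschitz. }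
  assert (Hk : 0 < lambda * (L * 2)) by (apply Rmult_lt_0_compat; lra).
  assert (HG0 : G zero = zero) by (unfold G; rewrite HF0; exact (scal_zero_r (- lambda))).
  destruct (picard_solution H SG HSG G _ Hk HG z0 HG0) as [z [Hzc Hz]].
  assert (HzF : clamped_mild F lambda z0 z) by now split.
  assert (Hzn : forall t, 0 <= t -> norm (z t) <= R0).
  { intros t Ht; eapply Rle_trans; [|exact Hz0].
    now apply (clamped_mild_norm_le F HFpos HFc lambda Hl). }
  exists z; split.
  - split; [easy|]; intros t Ht; rewrite (Hz t Ht) at 1.
    apply picard_map_ext; [|easy]; intros s Hs; unfold G, F.
    rewrite radial_proj_id; [easy|easy|now apply Hzn].
  (* A competitor obeys the a priori bound for [B] itself, so it solves the truncated equation too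
     and differs from [z] by at most [R0 + R0]. *)
  - intros z' Hz'.
    assert (Hz'B := is_mild_solution_clamped B lambda z0 z' HBc Hz').
    assert (Hz'n : forall t, 0 <= t -> norm (z' (Rmax 0 t)) <= R0).
    { intros t Ht; eapply Rle_trans; [|exact Hz0].
      now apply (clamped_mild_norm_le B HBpos HBc lambda Hl z0 (fun t => z' (Rmax 0 t))). }
    intros t Ht; rewrite <- (Rmax_right 0 t) at 1 by easy.
    apply (picard_fixpoint_unique H SG HSG G _ Hk HG z0 (fun t => z' (Rmax 0 t)) z (R0 + R0));
      try easy; [apply (proj1 Hz'B)|..].
    + intros s Hs; rewrite (proj2 Hz'B s Hs) at 1.
      apply picard_map_ext; [|easy]; intros r Hr; unfold G, F.
      rewrite radial_proj_id; [easy|easy|now apply Hz'n].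
    + intros s Hs; eapply Rle_trans; [apply norm_minus_le|].
      apply Rplus_le_compat; [now apply Hz'n|now apply Hzn].
Qed.

End Stabilization.

Theorem theorem3
  (H : CompleteNormedModule R_AbsRing)
  (inner : H -> H -> R)
  (Hinner : is_inner_product H inner)
  (domA : H -> Prop) (A : H -> H) (S0 : R -> H -> H)
  (HS0 : is_contraction_semigroup H S0)
  (HA : is_generator H domA A S0)
  (B : H -> H)
  (HB0 : B zero = zero)
  (HBpos : forall z : H, 0 <= inner (B z) z)
  (HBlip : lipschitz_on_bounded_subsets H B)
  (T delta : R) (HT : 0 < T) (Hdelta : 0 < delta)
  (Hobs : forall y : H,
     RInt (fun t => Rabs (inner (B (S0 t y)) (S0 t y))) 0 T
       >= delta * norm y ^ 2) :
  forall R0 : R, 0 < R0 ->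
  exists lambdaR : R, 0 < lambdaR /\
  forall lambda : R, 0 < lambda < lambdaR ->
  exists M sigma : R, 0 < M /\ 0 < sigma /\
  forall z0 : H, norm z0 <= R0 ->
  exists z : R -> H,
    is_mild_solution H S0 B lambda z0 z /\
    (forall z' : R -> H, is_mild_solution H S0 B lambda z0 z' ->
       forall t : R, 0 <= t -> z' t = z t) /\
    (forall t : R, 0 <= t ->
       norm (z t) <= M * exp (- sigma * t) * norm z0).
Proof.
  intros R0 HR0.
  destruct (HBlip (fun x => norm x <= R0)) as [L0 HL0]; [now exists R0|].
  (* [L0] might vanish or be negative, while [L] enters a denominator below. *)
  set (L := Rmax L0 1).
  assert (HL : 1 <= L) by apply Rmax_r.
  assert (HBl : forall x y, norm x <= R0 -> norm y <= R0 ->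
    norm (minus (B x) (B y)) <= L * norm (minus x y)).
  { intros x y Hx Hy; eapply Rle_trans; [now apply HL0|].
    apply Rmult_le_compat_r; [apply norm_ge_0|apply Rmax_l]. }
  assert (HBb : forall x, norm x <= R0 -> norm (B x) <= L * norm x).
  { intros x Hx.
    assert (E : minus (B x) (B zero) = B x)
      by (rewrite HB0; exact (minus_zero_R H (B x))).
    assert (E0 : minus x zero = x) by exact (minus_zero_R H x).
    assert (Hz : norm (zero : H) <= R0) by (rewrite norm_zero_R; lra).
    assert (Hx0 : norm (minus (B x) (B zero)) <= L * norm (minus x zero))
      by exact (HBl x zero Hx Hz).
    now rewrite E, E0 in Hx0. }
  assert (HBc : forall (w : R -> H) t, continuous w t -> continuous (fun s => B (w s)) t)
    by (intros w t; now apply locally_lipschitz_comp_continuous).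
  assert (HLT : 0 < 4 * L ^ 2 * T ^ 2).
  { apply Rmult_lt_0_compat; [apply Rmult_lt_0_compat|]; try apply pow_lt; lra. }
  (* The first bound keeps the transfer error 2 lambda L^2 T^2 below delta / 2, which leaves the
     factor 1 - lambda delta; the second keeps that factor positive, so that its logarithm makes
     sense. *)
  exists (Rmin (delta / (4 * L ^ 2 * T ^ 2)) (1 / (2 * delta))); split.
  { apply Rmin_glb_lt; apply Rdiv_lt_0_compat; lra. }
  intros lambda [Hl0 Hl].
  assert (Hl1 : lambda * (4 * L ^ 2 * T ^ 2) < delta).
  { apply Rlt_le_trans with (delta / (4 * L ^ 2 * T ^ 2) * (4 * L ^ 2 * T ^ 2)).
    - apply Rmult_lt_compat_r; [easy|].
      eapply Rlt_le_trans; [exact Hl|apply Rmin_l].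
    - right; field; split; lra. }
  assert (Hl2 : lambda * (2 * delta) < 1).
  { apply Rlt_le_trans with (1 / (2 * delta) * (2 * delta)).
    - apply Rmult_lt_compat_r; [lra|].
      eapply Rlt_le_trans; [exact Hl|apply Rmin_r].
    - right; field; lra. }
  set (q := 1 - lambda * delta).
  assert (Hld : 0 < lambda * delta) by now apply Rmult_lt_0_compat.
  assert (Hq : 0 < q < 1) by (unfold q; lra).
  assert (Hlnq : ln q < 0) by (rewrite <- ln_1; apply ln_increasing; lra).
  exists (exp (- ln q / 2)), (- ln q / (2 * T)); split; [apply exp_pos|].
  split; [apply Rdiv_lt_0_compat; lra|].
  intros z0 Hz0.
  destruct (mild_solution_exists_unique H S0 HS0 inner Hinner B lambda L R0 z0)
    as [z [Hz Huniq]]; try easy; [lra|].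
  exists z; split; [now apply clamped_mild_is_solution|split; [easy|]].
  rewrite <- (clamped_mild_init H S0 HS0 B lambda z0 z Hz).
  apply (geometric_decay_exponential (fun t => norm (z t)) q T Hq HT).
  - intros t _; apply norm_ge_0.
  - intros s t Hst; now apply (clamped_mild_nonincreasing H S0 HS0 inner Hinner B HBpos HBc
      lambda Hl0 z0).
  - intros s Hs.
    eapply Rle_trans; [now apply (clamped_mild_period_decay H S0 HS0 inner Hinner B HBpos
      HBc lambda Hl0 z0 z R0 L T delta s); try lra|].
    apply Rmult_le_compat_r; [apply pow2_ge_0|unfold q; nra].
Qed.
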